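(* Let $N^n\subset M^{n+1}\subset\mathbb{R}^{n+2}$ be a non-degenerate immersion. There exists a parallel vector field $\xi$ (in the osculating Darboux direction of $N\subset M$) if and only if the normal bundle is flat, i.e. $R^\perp=0$.
   Context: $M^{n+1}\subset\mathbb{R}^{n+2}$ is a hypersurface, $N^n\subset M$ is a codimension $1$ submanifold of $M$, and $D$ is the standard flat connection of $\mathbb{R}^{n+2}$. For a vector field $\eta$ along $N$ transversal to $M$, a vector field $\xi_1$ along $N$ tangent to $M$ and transversal to $N$, and $X,Y$ tangent to $N$, write $D_XY=\nabla_XY+h^1(X,Y)\xi_1+h^2(X,Y)\eta$ with $\nabla_XY$ tangent to $N$. The immersion $N\subset M$ is non-degenerate if the bilinear form $h^2$ is non-degenerate (this is independent of the choices of $\xi_1$ and $\eta$). In this case there is a unique direction along $N$, tangent to $M$ and transversal to $N$, such that a vector field $\xi$ in this direction has $D_X\xi$ tangent to $M$ for every $X$ tangent to $N$; it is called the osculating Darboux direction. A vector field $\xi$ in the osculating Darboux direction is called parallel if $D_X\xi$ is tangent to $N$ for every $X$ tangent to $N$. For $\xi$ in the osculating Darboux direction, $D_X\xi$ is tangent to $M$, so one can write $D_X\xi=-S_1X+\nabla^\perp_X\xi$, where $S_1X$ is tangent to $N$ and $\nabla^\perp_X\xi=\tau_1^1(X)\xi$ for a $1$-form $\tau_1^1$ on $N$ (depending on $\xi$). This defines the affine normal connection (normal bundle connection) $\nabla^\perp$. The normal curvature is $R^\perp(X,Y)\xi=\nabla^\perp_Y\nabla^\perp_X\xi-\nabla^\perp_X\nabla^\perp_Y\xi+\nabla^\perp_{[X,Y]}\xi$.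 The normal bundle is flat if $R^\perp(X,Y)\xi=0$ for all $X,Y\in T_pN$ and all $\xi=\lambda\xi_0$, where $\xi_0$ is a fixed vector field in the osculating Darboux direction and $\lambda$ is a scalar function.
   Formalization: The parallel vector field is only claimed near each point of N: a global one can fail when the normal bundle is flat, e.g. for closed curves N (n = 1), where the affine normal connection is always flat but can have nontrivial holonomy. *)

(* Defs.v *)
From HB Require Import structures.
From mathcomp Require Import all_boot all_order all_algebra.
From mathcomp Require Import all_classical all_reals all_analysis.

Set Implicit Arguments.
Unset Strict Implicit.
Unset Printing Implicit Defensive.

Import Order.TTheory GRing.Theory Num.Theory.
Import numFieldNormedType.Exports.

Local Open Scope classical_set_scope.
Local Open Scope ring_scope.

Section Smooth.
Context {R : realType} {U V : normedModType R}.

Fixpoint Ck_on (k : nat) (W : set U) (f : U -> V) : Prop :=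
  match k with
  | 0 => forall x, W x -> {for x, continuous f}
  | k'.+1 => (forall x, W x -> differentiable f x) /\
             forall v : U, Ck_on k' W (fun x => 'D_v f x)
  end.

(* Only meant for W open: the derivatives are those of f on the whole space. *)
Definition smooth_on (W : set U) (f : U -> V) : Prop :=
  forall k, Ck_on k W f.

(* For S not open, smoothness along S is the existence of local smooth
   extensions; the values of f outside S are irrelevant. *)
Definition smooth_along (S : set U) (f : U -> V) : Prop :=
  forall p, S p -> exists W g,
    [/\ open W, W p, smooth_on W g & forall x, W x -> S x -> g x = f x].

End Smooth.

Section Submanifolds.
Context {R : realType} {n : nat}.
Local Notation E := 'rV[R]_n.+2.
Implicit Types (S M N : set E) (f xi X Y eta : E -> E) (p v w : E).

(* Embedded k-dimensional submanifold of E, by slice charts: near each of its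
   points a diffeomorphism Phi of open sets, with inverse Psi, straightens S
   to the coordinate subspace where all coordinates of index >= k vanish. *)
Definition submanifold (k : nat) S : Prop :=
  forall p, S p -> exists (W W' : set E) (Phi Psi : E -> E),
    [/\ open W, open W' & W p] /\
    [/\ smooth_on W Phi, smooth_on W' Psi,
        (forall x, W x -> W' (Phi x) /\ Psi (Phi x) = x),
        (forall y, W' y -> W (Psi y) /\ Phi (Psi y) = y) &
        (forall x, W x ->
           (S x <-> forall i : 'I_n.+2, (k <= i)%N -> Phi x ord0 i = 0))].

Definition curve_in S p v (gamma : R -> E) : Prop :=
  exists2 e : R, 0 < e &
    [/\ smooth_on `]- e, e[ gamma, (forall t, t \in `]- e, e[ -> S (gamma t)),
        gamma 0 = p & is_derive (0 : R) (1 : R) gamma v].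

Definition tangent S p : set E := [set v | exists gamma, curve_in S p v gamma].

Definition tangent_field S X : Prop :=
  smooth_along S X /\ forall p, S p -> tangent S p (X p).

(* The flat connection of E along S: [flatD S f p v] is the derivative
   D_v f at p of the field f along S in the direction v tangent to S.
   It is computed along curves in S, since f matters on S only. *)
Definition flatD S f p v : E :=
  xget 0 [set w | exists gamma,
    curve_in S p v gamma /\ is_derive (0 : R) (1 : R) (f \o gamma) w].

Definition lie_bracket S X Y : E -> E :=
  fun p => flatD S Y p (X p) - flatD S X p (Y p).

Definition tangent_transversal M N xi : Prop :=
  smooth_along N xi /\
  forall p, N p -> tangent M p (xi p) /\ ~ tangent N p (xi p).

Definition transversal_along M N eta : Prop :=
  smooth_along N eta /\ forall p, N p -> ~ tangent M p (eta p).

(* The coefficient h^2 (x, y) at p in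
   D_X Y = nabla_X Y + h^1 (X, Y) xi1 + h^2 (X, Y) eta,
   for any field Y tangent to N near p extending the tangent vector y. *)
Definition h2 N xi1 eta p x y : R :=
  xget 0 [set c | exists (O : set E) Y,
    [/\ open O, O p, tangent_field (N `&` O) Y & Y p = y] /\
    exists (nabla : E) (h1 : R), tangent N p nabla /\
      flatD (N `&` O) Y p x = nabla + h1 *: xi1 p + c *: eta p].

(* Transversal fields xi1 and eta are only required locally: they always exist
   locally, need not exist globally, and their choice is immaterial. *)
Definition nondegenerate_immersion M N : Prop :=
  forall p, N p -> exists (O : set E) xi1 eta,
    [/\ open O, O p, tangent_transversal M (N `&` O) xi1 &
        transversal_along M (N `&` O) eta] /\
    forall q, (N `&` O) q -> forall x, tangent N q x ->
      (forall y, tangent N q y -> h2 (N `&` O) xi1 eta q x y = 0) -> x = 0.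

(* xi spans the osculating Darboux direction at every point of N; in
   particular it vanishes nowhere. *)
Definition darboux_field M N xi : Prop :=
  tangent_transversal M N xi /\
  forall p, N p -> forall v, tangent N p v -> tangent M p (flatD N xi p v).

Definition parallel_field M N xi : Prop :=
  darboux_field M N xi /\
  forall p, N p -> forall v, tangent N p v -> tangent N p (flatD N xi p v).

(* nabla^perp_X xi, the component of D_X xi = - S_1 X + nabla^perp_X xi in the
   Darboux line spanned by xi0. Here xi = lambda xi0 with lambda possibly
   vanishing somewhere, hence the separate argument xi0. *)
Definition normal_connection N xi0 X xi : E -> E :=
  fun p => xget 0 [set w | exists (SX : E) (c : R),
    [/\ tangent N p SX, w = c *: xi0 p & flatD N xi p (X p) = - SX + w]].

Definition normal_curvature N xi0 X Y xi : E -> E :=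
  fun p => normal_connection N xi0 Y (normal_connection N xi0 X xi) p
         - normal_connection N xi0 X (normal_connection N xi0 Y xi) p
         + normal_connection N xi0 (lie_bracket N X Y) xi p.

(* R^perp = 0. The field xi0 is local, as the Darboux line bundle may have no
   global nowhere vanishing section. *)
Definition flat_normal_bundle M N : Prop :=
  forall (O : set E) xi0, open O -> darboux_field M (N `&` O) xi0 ->
  forall (lambda : E -> R) X Y,
    smooth_along (N `&` O) lambda ->
    tangent_field (N `&` O) X -> tangent_field (N `&` O) Y ->
  forall p, (N `&` O) p ->
    normal_curvature (N `&` O) xi0 X Y (fun q => lambda q *: xi0 q) p = 0.

(* A parallel field near each point of N: around a non-contractible loop of N
   a flat connection may have holonomy, so no global one need exist. *)
Definition locally_has_parallel_field M N : Prop :=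
  forall p, N p -> exists (O : set E) xi,
    [/\ open O, O p & parallel_field M (N `&` O) xi].

End Submanifolds.

(* Main.v *)
(* Near a point of N, let r be a smooth retraction of an open set onto N and F a
   submersion defining M. Then T_q N and T_q M are the fixed vectors of dr_q and
   the kernel of dF_q, h^2 is proportional to the Hessian of F on T_q N, and the
   Darboux direction is the line of T_q M which is orthogonal to T_q N for this
   Hessian; it depends smoothly on q. For a field x0 in this direction, write
   D_v x0 = tau(v) x0 modulo T_q N. The normal curvature of f x0 is then, up to
   sign, f dtau x0, and exp(-phi) x0 is parallel if and only if dphi = tau. If the
   curvature vanishes, r^* tau is a closed 1-form on an open subset of the
   ambient space, so that the Poincare lemma on a ball gives phi. *)

Require Import Defs.
From mathcomp Require Import all_boot all_order all_algebra.
From mathcomp Require Import all_classical all_reals all_analysis.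
From mathcomp Require Import ring lra.

Set Implicit Arguments.
Unset Strict Implicit.
Unset Printing Implicit Defensive.

Import Order.TTheory GRing.Theory Num.Theory.
Import numFieldNormedType.Exports.

Local Open Scope classical_set_scope.
Local Open Scope ring_scope.

(** * Smooth functions *)

(** A field or a form on N has no meaning off N, and tangency and closedness are only known on
    vectors tangent to N. Everything is therefore computed with smooth extensions to open sets of
    the ambient space and with directions in T_q N, for which the derivative does not depend on the
    extension. The retraction supplies what an extension alone does not: a constant vector u yields
    the tangent field dr(u), and r^* tau is closed in all ambient directions because dr takes its
    values in tangent spaces of N. An arbitrary extension of tau has no reason to be closed. The
    Darboux field has to be smooth on an open set, whereas the Hessian of F is known to be
    non-degenerate on T_q N only at points q of N. It is given by Cramer's rule with the denominator
    cleared, so that nothing has to be inverted off N. Flatness is tested on an arbitrary Darboux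
    field, which need not be the given parallel one. Non-degeneracy makes the two proportional, and
    the form tau of the parallel field is 0. *)

Section Differentiability.
Context {R : realType} {U V : normedModType R}.
Implicit Types (f g : U -> V) (x v : U).

(** The first-order expansion in epsilon form, from which derivatives are built by hand: for
    functions that agree locally, and for the radial primitive of a closed form. *)
Lemma differentiable_approx f x (L : {linear U -> V}) : continuous L ->
  (forall e : R, 0 < e -> \forall h \near (0 : U),
     `|f (h + x) - f x - L h| <= e * `|h|) ->
  differentiable f x /\ 'd f x = L :> (U -> V).
Proof.
move=> Lc fL.
have E : f \o shift x = cst (f x) + L +o_ 0 id.
  by apply/eqaddoP => _/posnumP[e]; near=> h; rewrite opprD addrA /=;
    near: h; exact: fL.
have dE := diff_unique Lc E.
split => //; apply/diff_locallyP; rewrite dE; split => //.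
Unshelve. all: by end_near. Qed.

Lemma differentiable_approxE f x : differentiable f x ->
  forall e : R, 0 < e -> \forall h \near (0 : U),
     `|f (h + x) - f x - 'd f x h| <= e * `|h|.
Proof.
move=> /diff_locally /eqaddoP fE e e0; near=> h.
have : `|((f \o shift x) - (cst (f x) + 'd f x)) h| <= e * `|h|.
  by near: h; exact: fE.
by rewrite opprD addrA.
Unshelve. all: by end_near. Qed.

Lemma near_eq_differentiable f g x :
  (\forall y \near x, f y = g y) -> differentiable f x -> differentiable g x.
Proof.
move=> fg df; apply: (proj1 (@differentiable_approx g x ('d f x) _ _)).
  exact: diff_continuous.
move=> e e0; near=> h.
have <- : f x = g x by exact: nbhs_singleton fg.
have <- : f (h + x) = g (h + x).
  by near: h; move: fg; rewrite (near_shift 0 x) subr0; apply: filterS.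
by near: h; exact: differentiable_approxE.
Unshelve. all: by end_near. Qed.

End Differentiability.

Section Chain.
Context {R : realType}.

Lemma is_derive_comp_diff {V W : normedModType R} (f : V -> W) (g : R -> V)
    (t : R) (w : V) :
  differentiable f (g t) -> is_derive t 1 g w ->
  is_derive t 1 (f \o g) ('D_w f (g t)).
Proof.
move=> df dg.
have dg' : differentiable g t by apply/derivable1_diffP.
have dfg : differentiable (f \o g) t by exact: differentiable_comp.
apply: DeriveDef; first by apply/derivable1_diffP.
rewrite deriveE // diff_comp //= (deriveE _ df).
by rewrite -(deriveE (1 : R) dg') derive_val.
Qed.

Lemma is_derive_line {V : normedModType R} (x v : V) (t : R) :
  is_derive t 1 (fun s : R => x + s *: v) v.
Proof.
have -> : (fun s : R => x + s *: v) = cst x + ( *:%R ^~ v) by [].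
have d : differentiable ( *:%R ^~ v : R -> V) t by [].
have dv : is_derive t 1 ( *:%R ^~ v : R -> V) v.
  apply: DeriveDef; first by apply/derivable1_diffP.
  by rewrite deriveE // diff_val scale1r.
by have := is_deriveD (is_derive_cst x t (1 : R)) dv; rewrite add0r.
Qed.

Lemma is_derive_along {V W : normedModType R} (f : V -> W) (x v : V) (t : R) :
  differentiable f (x + t *: v) ->
  is_derive t 1 (fun s : R => f (x + s *: v)) ('D_v f (x + t *: v)).
Proof.
move=> df; have := @is_derive_comp_diff _ _ f (fun s : R => x + s *: v) t v.
by apply => //; exact: is_derive_line.
Qed.

Lemma mean_value_line {V : normedModType R} (f : V -> R) (x v : V) :
  (forall t : R, 0 <= t <= 1 -> differentiable f (x + t *: v)) ->
  exists2 c : R, 0 <= c <= 1 & f (x + v) - f x = 'D_v f (x + c *: v).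
Proof.
move=> df.
have [c c01] : exists2 c : R, c \in `]0, 1[%R &
    (f \o (fun s : R => x + s *: v)) 1 - (f \o (fun s : R => x + s *: v)) 0
      = 'D_v f (x + c *: v) * (1 - 0).
  apply: (@MVT R (f \o (fun s : R => x + s *: v))
     (fun c => 'D_v f (x + c *: v)) 0 1) => //.
    move=> t; rewrite in_itv /= => /andP[t0 t1]; apply: is_derive_along.
    by apply: df; rewrite !ltW.
  apply: derivable_within_continuous => t; rewrite in_itv /= => t01.
  by have [] := is_derive_along (df t t01).
rewrite /= scale1r scale0r addr0 subr0 mulr1 => E.
by exists c => //; move: c01; rewrite in_itv /= => /andP[/ltW-> /ltW->].
Qed.

End Chain.

(** * Stability of C^k functions under the usual operations *)

Section CkOn.
Context {R : realType} {U : normedModType R}.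
Implicit Types (W : set U).

Section General.
Context {V : normedModType R}.
Implicit Types (f g : U -> V).

Lemma Ck_on_ext k W f g : open W -> (forall x, W x -> f x = g x) ->
  Ck_on k W f -> Ck_on k W g.
Proof.
move=> oW; elim: k f g => [|k IH] f g fg /=.
  move=> fc x Wx; have := fc x Wx.
  rewrite /prop_for /continuous_at -(fg x Wx); apply: cvg_trans.
  apply: near_eq_cvg; near do rewrite fg//.
  exact: (open_nbhs_nbhs (conj oW Wx)).
move=> [df Df]; have nfg x : W x -> \forall y \near x, f y = g y.
  by move=> Wx; near do apply: fg; exact: (open_nbhs_nbhs (conj oW Wx)).
split=> [x Wx|v]; first exact: near_eq_differentiable (nfg x Wx) (df x Wx).
by apply: IH (Df v) => x Wx; apply: near_eq_derive (nfg x Wx).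
Unshelve. all: by end_near. Qed.

Lemma Ck_on_sub k W W' f : W' `<=` W -> Ck_on k W f -> Ck_on k W' f.
Proof.
move=> WW'; elim: k f => [|k IH] f /=; first by move=> fc x /WW'; exact: fc.
by move=> [df Df]; split=> [x /WW'|v]; [exact: df|exact: IH].
Qed.

Lemma Ck_onW k W f : Ck_on k.+1 W f -> Ck_on k W f.
Proof.
elim: k f => [|k IH] f /= [df Df].
  by move=> x Wx; exact: differentiable_continuous (df x Wx).
by split=> // v; apply: IH; exact: Df.
Qed.

Lemma Ck_on_cst k W (a : V) : Ck_on k W (fun=> a).
Proof.
elim: k a => [|k IH] a /=; first by move=> x _; exact: cvg_cst.
split=> [x _|v]; first exact: differentiable_cst.
have -> : (fun x => 'D_v (fun=> a) x) = (fun=> 0 : V).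
  by apply: funext => x; exact: derive_cst.
exact: IH.
Qed.

Lemma Ck_onD k W f g : open W -> Ck_on k W f -> Ck_on k W g ->
  Ck_on k W (fun x => f x + g x).
Proof.
move=> oW; elim: k f g => [|k IH] f g /=.
  by move=> fc gc x Wx; apply: cvgD; [exact: fc|exact: gc].
move=> [df Df] [dg Dg]; split=> [x Wx|v].
  by apply: differentiableD; [exact: df|exact: dg].
apply: Ck_on_ext (IH _ _ (Df v) (Dg v)) => // x Wx.
by rewrite -deriveD //; apply: diff_derivable; [exact: df|exact: dg].
Qed.

Lemma Ck_on_sum k W (I : Type) (r : seq I) (P : pred I) (f : I -> U -> V) :
  open W -> (forall i, Ck_on k W (f i)) ->
  Ck_on k W (fun x => \sum_(i <- r | P i) f i x).
Proof.
move=> oW fk; elim: r => [|i r IH].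
  by under eq_fun do rewrite big_nil; exact: Ck_on_cst.
under eq_fun do rewrite big_cons; case: (P i) => //; exact: Ck_onD.
Qed.

End General.

Lemma Ck_on_coord k W m (f : U -> 'rV[R]_m) i : open W ->
  Ck_on k W f -> Ck_on k W (fun x => f x ord0 i).
Proof.
move=> oW; elim: k f => [|k IH] f /=.
  move=> fc x Wx.
  exact: (continuous_comp (fc x Wx) (@coord_continuous _ _ _ ord0 i (f x))).
move=> [df Df]; split=> [x Wx|v].
  apply: (@differentiable_comp _ _ _ _ f (fun y : 'rV[R]_m => y ord0 i)).
    exact: df.
  exact: differentiable_coord.
apply: Ck_on_ext (IH _ (Df v)) => // x Wx.
by rewrite derive_mx ?mxE //; apply: diff_derivable; exact: df.
Qed.

Lemma rV_sum_coord m (f : U -> 'rV[R]_m) :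
  f = fun x => \sum_i f x ord0 i *: delta_mx ord0 i.
Proof. by apply: funext => x; rewrite -row_sum_delta. Qed.

Lemma differentiable_rV m (f : U -> 'rV[R]_m) x :
  (forall i, differentiable (fun y => f y ord0 i) x) -> differentiable f x.
Proof.
move=> df; rewrite (rV_sum_coord f).
have -> : (fun y => \sum_i f y ord0 i *: delta_mx ord0 i) =
  \sum_i (fun y => f y ord0 i *: (delta_mx ord0 i : 'rV[R]_m)).
  by apply: funext => y; rewrite fct_sumE.
by apply: differentiable_sum => i; exact: differentiableZl.
Qed.

Lemma Ck_on_rV k W m (f : U -> 'rV[R]_m) : open W ->
  (forall i, Ck_on k W (fun x => f x ord0 i)) -> Ck_on k W f.
Proof.
move=> oW; elim: k f => [|k IH] f /= fk.
  rewrite (rV_sum_coord f); apply: (@Ck_on_sum _ 0) => // i x Wx.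
  exact: (cvgZr_tmp (fk i x Wx)).
have df x : W x -> differentiable f x.
  by move=> Wx; apply: differentiable_rV => i; exact: (fk i).1.
split=> // v; apply: IH => i.
apply: Ck_on_ext ((fk i).2 v) => // x Wx.
by rewrite derive_mx ?mxE //; apply: diff_derivable; exact: df.
Qed.

Lemma Ck_onM k W (f g : U -> R) : open W -> Ck_on k W f -> Ck_on k W g ->
  Ck_on k W (fun x => f x * g x).
Proof.
move=> oW; elim: k f g => [|k IH] f g.
  by move=> /= fc gc x Wx; apply: cvgM; [exact: fc|exact: gc].
move=> fk gk; have [df Df] := fk; have [dg Dg] := gk; split=> [x Wx|v].
  by apply: differentiableM; [exact: df|exact: dg].
have := Ck_onD oW (IH _ _ (Ck_onW fk) (Dg v)) (IH _ _ (Ck_onW gk) (Df v)).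
apply: Ck_on_ext => // x Wx.
by rewrite -deriveM //; apply: diff_derivable; [exact: df|exact: dg].
Qed.

(** Induction through D_v (1/f) = - (1/f)^2 D_v f, where 1/f is needed only to the order already
    reached. *)
Lemma Ck_onV k W (f : U -> R) : open W -> (forall x, W x -> f x != 0) ->
  Ck_on k W f -> Ck_on k W (fun x => (f x)^-1).
Proof.
move=> oW f0; elim: k => [|k IH] fk.
  by move=> x Wx; apply: cvgV; [exact: f0|exact: fk].
have [df Df] := fk; split=> [x Wx|v].
  by apply: differentiableV; [exact: df|exact: f0].
have Vk := IH (Ck_onW fk).
have := Ck_onM oW (Ck_onM oW (@Ck_on_cst R k W (-1)) (Ck_onM oW Vk Vk)) (Df v).
apply: Ck_on_ext => // x Wx.
rewrite deriveV ?f0 //; last by apply: diff_derivable; exact: df.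
by rewrite mulN1r -expr2 exprVn.
Qed.

Lemma derive_expR_comp (f : U -> R) x v : differentiable f x ->
  differentiable (fun y => expR (f y)) x /\
  'D_v (fun y => expR (f y)) x = expR (f x) * 'D_v f x.
Proof.
move=> df; have de : differentiable (expR : R -> R) (f x).
  by apply/derivable1_diffP; exact: derivable_expR.
have dc : differentiable (expR \o f) x by exact: differentiable_comp.
split=> //; rewrite deriveE // diff_comp //= deriveE //.
rewrite -[X in 'd _ _ X]mulr1 -[X in 'd _ _ X]/(_ *: (1 : R)) linearZ /=.
by rewrite -(deriveE (1 : R) de) derive_val mulrC.
Qed.

Lemma Ck_on_exp k W (f : U -> R) : open W ->
  Ck_on k W f -> Ck_on k W (fun x => expR (f x)).
Proof.
move=> oW; elim: k => [|k IH] fk.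
  by move=> x Wx; apply: (continuous_comp (fk x Wx)); exact: continuous_expR.
have [df Df] := fk; split=> [x Wx|v].
  exact: (derive_expR_comp 0 (df x Wx)).1.
have := Ck_onM oW (IH (Ck_onW fk)) (Df v).
apply: Ck_on_ext => // x Wx.
by rewrite (derive_expR_comp v (df x Wx)).2.
Qed.

End CkOn.

Section Composition.
Context {R : realType}.

Lemma derive_basis m (V : normedModType R) (f : 'rV[R]_m -> V) x v :
  differentiable f x -> 'D_v f x = \sum_i v ord0 i *: 'D_(delta_mx ord0 i) f x.
Proof.
move=> df; rewrite deriveE // [in LHS](row_sum_delta v) linear_sum.
by apply: eq_bigr => i _; rewrite linearZ /= deriveE.
Qed.

Lemma derive_compE (U V W : normedModType R) (f : V -> W) (g : U -> V) x v :
  differentiable g x -> differentiable f (g x) ->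
  'D_v (f \o g) x = 'D_('D_v g x) f (g x).
Proof.
move=> dg df; have dfg := differentiable_comp dg df.
by rewrite (deriveE _ dfg) (diff_comp dg df) (deriveE _ dg) (deriveE _ df).
Qed.

(** The chain rule in coordinates: D_v (f o g) is the sum of the coordinates of D_v g times the
    partial derivatives of f composed with g. The induction is over all [f], since it is applied to
    these partial derivatives. *)
Lemma Ck_on_comp k (U : normedModType R) m (W : set U) (O : set 'rV[R]_m)
    (f : 'rV[R]_m -> R) (g : U -> 'rV[R]_m) : open W ->
  (forall x, W x -> O (g x)) -> Ck_on k O f -> Ck_on k W g ->
  Ck_on k W (f \o g).
Proof.
move=> oW gO; elim: k f => [|k IH] f fk gk.
  by move=> x Wx; apply: continuous_comp; [exact: gk|apply/fk/gO].
have [df Df] := fk; have [dg Dg] := gk; split=> [x Wx|v].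
  by apply: differentiable_comp; [exact: dg|apply/df/gO].
apply: (@Ck_on_ext _ _ _ k W (fun x => \sum_i
  ('D_v g x) ord0 i * ('D_(delta_mx ord0 i) f \o g) x)) => //.
  move=> x Wx; rewrite (derive_compE _ (dg x Wx) (df _ (gO _ Wx))).
  by rewrite (derive_basis _ (df _ (gO _ Wx))).
apply: Ck_on_sum => // i; apply: Ck_onM => //.
  by apply: Ck_on_coord => //; exact: Dg.
by apply: IH; [exact: Df|exact: Ck_onW].
Qed.

End Composition.

Section SmoothOn.
Context {R : realType} {U : normedModType R}.
Implicit Types (W : set U).

Lemma smooth_on_ext (V : normedModType R) W (f g : U -> V) :
  open W -> (forall x, W x -> f x = g x) -> smooth_on W f -> smooth_on W g.
Proof. by move=> oW fg fs k; exact: Ck_on_ext fg (fs k). Qed.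

Lemma smooth_on_sub (V : normedModType R) W W' (f : U -> V) :
  W' `<=` W -> smooth_on W f -> smooth_on W' f.
Proof. by move=> WW' fs k; exact: Ck_on_sub WW' (fs k). Qed.

Lemma smooth_on_diff (V : normedModType R) W (f : U -> V) x :
  smooth_on W f -> W x -> differentiable f x.
Proof. by move=> /(_ 1%N)[+ _]; apply. Qed.

Lemma smooth_on_continuous (V : normedModType R) W (f : U -> V) x :
  smooth_on W f -> W x -> {for x, continuous f}.
Proof. by move=> /(_ 0%N); apply. Qed.

Lemma smooth_on_derive (V : normedModType R) W (f : U -> V) v :
  smooth_on W f -> smooth_on W ('D_v f).
Proof. by move=> fs k; exact: (fs k.+1).2. Qed.

Lemma smooth_on_cst (V : normedModType R) W (a : V) : smooth_on W (fun=> a).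
Proof. by move=> k; exact: Ck_on_cst. Qed.

Lemma smooth_onD (V : normedModType R) W (f g : U -> V) : open W ->
  smooth_on W f -> smooth_on W g -> smooth_on W (fun x => f x + g x).
Proof. by move=> oW fs gs k; exact: Ck_onD. Qed.

Lemma smooth_on_sum (V : normedModType R) W (I : Type) (r : seq I) (P : pred I)
    (f : I -> U -> V) : open W -> (forall i, smooth_on W (f i)) ->
  smooth_on W (fun x => \sum_(i <- r | P i) f i x).
Proof. by move=> oW fs k; apply: Ck_on_sum => // i; exact: fs. Qed.

Lemma smooth_onM W (f g : U -> R) : open W ->
  smooth_on W f -> smooth_on W g -> smooth_on W (fun x => f x * g x).
Proof. by move=> oW fs gs k; exact: Ck_onM. Qed.

Lemma smooth_onN W (f : U -> R) : open W ->
  smooth_on W f -> smooth_on W (fun x => - f x).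
Proof.
move=> oW fs; under eq_fun do rewrite -mulN1r.
by apply: smooth_onM => //; exact: smooth_on_cst.
Qed.

Lemma smooth_on_prod W (I : Type) (r : seq I) (P : pred I)
    (f : I -> U -> R) : open W -> (forall i, smooth_on W (f i)) ->
  smooth_on W (fun x => \prod_(i <- r | P i) f i x).
Proof.
move=> oW fs; elim: r => [|i r IH].
  by under eq_fun do rewrite big_nil; exact: smooth_on_cst.
by under eq_fun do rewrite big_cons; case: (P i) => //; exact: smooth_onM.
Qed.

Lemma smooth_onV W (f : U -> R) : open W -> (forall x, W x -> f x != 0) ->
  smooth_on W f -> smooth_on W (fun x => (f x)^-1).
Proof. by move=> oW f0 fs k; exact: Ck_onV. Qed.

Lemma smooth_on_exp W (f : U -> R) : open W ->
  smooth_on W f -> smooth_on W (fun x => expR (f x)).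
Proof. by move=> oW fs k; exact: Ck_on_exp. Qed.

Lemma smooth_on_coord W m (f : U -> 'rV[R]_m) i : open W ->
  smooth_on W f -> smooth_on W (fun x => f x ord0 i).
Proof. by move=> oW fs k; exact: Ck_on_coord. Qed.

Lemma smooth_on_rV W m (f : U -> 'rV[R]_m) : open W ->
  (forall i, smooth_on W (fun x => f x ord0 i)) -> smooth_on W f.
Proof. by move=> oW fs k; apply: Ck_on_rV => // i; exact: fs. Qed.

Lemma smooth_onZ W m (a : U -> R) (f : U -> 'rV[R]_m) : open W ->
  smooth_on W a -> smooth_on W f -> smooth_on W (fun x => a x *: f x).
Proof.
move=> oW sa sf; apply: smooth_on_rV => // i; under eq_fun do rewrite mxE.
by apply: smooth_onM => //; exact: smooth_on_coord.
Qed.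

Lemma smooth_on_comp m l W (O : set 'rV[R]_m)
    (f : 'rV[R]_m -> 'rV[R]_l) (g : U -> 'rV[R]_m) : open W -> open O ->
  (forall x, W x -> O (g x)) -> smooth_on O f -> smooth_on W g ->
  smooth_on W (f \o g).
Proof.
move=> oW oO gO fs gs; apply: smooth_on_rV => // i k.
apply: (@Ck_on_comp _ _ _ _ W O (fun y => f y ord0 i)) => //.
exact: Ck_on_coord.
Qed.

(** Bootstraps the potential of a closed form, which is first known only to be differentiable with
    prescribed derivatives. *)
Lemma smooth_on_primitive (V : normedModType R) W (f : U -> V)
    (g : U -> U -> V) : open W -> (forall x, W x -> differentiable f x) ->
  (forall v x, W x -> 'D_v f x = g v x) -> (forall v, smooth_on W (g v)) ->
  smooth_on W f.
Proof.
move=> oW df Df gs [|k] /=.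
  by move=> x Wx; exact: differentiable_continuous (df x Wx).
by split=> // v; apply: Ck_on_ext (gs v k) => // x Wx; rewrite Df.
Qed.

Lemma smooth_on_linear (V : normedModType R) W (f : {linear U -> V}) :
  continuous f -> smooth_on W f.
Proof.
move=> fc [|k] /=; first by move=> x _; exact: fc.
split=> [x _|v]; first exact: linear_differentiable.
have -> : (fun x => 'D_v f x) = fun=> f v; last exact: Ck_on_cst.
apply: funext => x; rewrite deriveE; last exact: linear_differentiable.
by rewrite diff_lin.
Qed.

Lemma smooth_on_id W : smooth_on W (fun x : U => x).
Proof. by apply: (@smooth_on_linear U W idfun) => x; exact: cvg_id. Qed.

End SmoothOn.

(** * Euclidean scalar product, through which vectors represent 1-forms *)

Section DotProduct.
Context {R : realType} {m : nat}.
Implicit Types (u v w : 'rV[R]_m).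

Definition dot u v : R := \sum_i u ord0 i * v ord0 i.

Lemma dotC u v : dot u v = dot v u.
Proof. by apply: eq_bigr => i _; rewrite mulrC. Qed.

Lemma dotDl u v w : dot (u + v) w = dot u w + dot v w.
Proof. by rewrite -big_split; apply: eq_bigr => i _; rewrite mxE mulrDl. Qed.

Lemma dotZl a u v : dot (a *: u) v = a * dot u v.
Proof. by rewrite big_distrr; apply: eq_bigr => i _; rewrite mxE -mulrA. Qed.

Lemma dotNl u v : dot (- u) v = - dot u v.
Proof. by rewrite -scaleN1r dotZl mulN1r. Qed.

Lemma dotBl u v w : dot (u - v) w = dot u w - dot v w.
Proof. by rewrite dotDl dotNl. Qed.

Lemma dotDr u v w : dot u (v + w) = dot u v + dot u w.
Proof. by rewrite dotC dotDl !(dotC u). Qed.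

Lemma dotBr u v w : dot u (v - w) = dot u v - dot u w.
Proof. by rewrite dotC dotBl !(dotC u). Qed.

Lemma dot0r u : dot u 0 = 0.
Proof. by apply: big1 => i _; rewrite mxE mulr0. Qed.

Lemma dot0l u : dot 0 u = 0.
Proof. by rewrite dotC dot0r. Qed.

Lemma dot_eq0 u : dot u u = 0 -> u = 0.
Proof.
move=> /eqP; rewrite psumr_eq0 => [/allP u0|i _]; last exact: sqr_ge0.
apply/rowP => i; rewrite mxE; apply/eqP.
by have := u0 i (mem_index_enum _); rewrite mulf_eq0 orbb.
Qed.

(** The norm on row vectors is the maximum norm, whence the factor m. *)
Lemma dot_le u v (e : R) : (forall i, `|v ord0 i| <= e) ->
  `|dot u v| <= m%:R * `|u| * e.
Proof.
move=> ve; apply: (le_trans (ler_norm_sum _ _ _)).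
apply: (@le_trans _ _ (\sum_(i < m) `|u| * e)).
  apply: ler_sum => i _; rewrite normrM ler_pM //.
  rewrite [leRHS]/Num.Def.normr/= mx_normrE.
  exact: (le_bigmax _ (fun i : 'I_1 * 'I_m => `|u i.1 i.2|) (ord0, i)).
by rewrite sumr_const card_ord -[leLHS]mulr_natl mulrA.
Qed.

End DotProduct.

Section DirectionalDerivative.
Context {R : realType}.

Lemma derive_ext (U V : normedModType R) (W : set U) (f g : U -> V) x v :
  open W -> W x -> (forall y, W y -> f y = g y) -> 'D_v f x = 'D_v g x.
Proof.
move=> oW Wx fg; apply: near_eq_derive; near do apply: fg.
exact: (open_nbhs_nbhs (conj oW Wx)).
Unshelve. all: by end_near. Qed.

Lemma deriveDdir (U V : normedModType R) (f : U -> V) x u v :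
  differentiable f x -> 'D_(u + v) f x = 'D_u f x + 'D_v f x.
Proof. by move=> df; rewrite !(deriveE _ df) linearD. Qed.

Lemma deriveZdir (U V : normedModType R) (f : U -> V) x (a : R) u :
  differentiable f x -> 'D_(a *: u) f x = a *: 'D_u f x.
Proof. by move=> df; rewrite !(deriveE _ df) linearZ. Qed.

Lemma deriveBdir (U V : normedModType R) (f : U -> V) x u v :
  differentiable f x -> 'D_(u - v) f x = 'D_u f x - 'D_v f x.
Proof. by move=> df; rewrite !(deriveE _ df) linearB. Qed.

Context {U : normedModType R}.

Lemma differentiable_coord_comp m (f : U -> 'rV[R]_m) x i :
  differentiable f x -> differentiable (fun y => f y ord0 i) x.
Proof.
move=> df; have dc := @differentiable_coord R 1 m (f x) ord0 i.
exact: (differentiable_comp df dc).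
Qed.

Lemma derive_coord m (f : U -> 'rV[R]_m) x v i :
  differentiable f x -> ('D_v f x) ord0 i = 'D_v (fun y => f y ord0 i) x.
Proof. by move=> df; rewrite derive_mx ?mxE //; exact: diff_derivable. Qed.

Lemma derive_mul (f g : U -> R) x v :
  differentiable f x -> differentiable g x ->
  'D_v (fun y => f y * g y) x = 'D_v f x * g x + f x * 'D_v g x.
Proof.
move=> df dg.
have -> : (fun y => f y * g y) = f * g by [].
rewrite deriveM; [|exact: diff_derivable|exact: diff_derivable].
by rewrite addrC mulrC.
Qed.

Lemma derive_dot m (f g : U -> 'rV[R]_m) x v :
  differentiable f x -> differentiable g x ->
  'D_v (fun y => dot (f y) (g y)) x = dot ('D_v f x) (g x) + dot (f x) ('D_v g x).
Proof.
move=> df dg; have df' i := differentiable_coord_comp i df.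
have dg' i := differentiable_coord_comp i dg.
have -> : (fun y => dot (f y) (g y)) =
    \sum_i (fun y => f y ord0 i * g y ord0 i).
  by apply: funext => y; rewrite fct_sumE.
rewrite derive_sum => [|i]; last by apply: diff_derivable; exact: differentiableM.
rewrite -big_split; apply: eq_bigr => i _.
by rewrite derive_mul // !derive_coord.
Qed.

Lemma derive_scale m (a : U -> R) (f : U -> 'rV[R]_m) x v :
  differentiable a x -> differentiable f x ->
  'D_v (fun y => a y *: f y) x = 'D_v a x *: f x + a x *: 'D_v f x.
Proof.
move=> da df; have df' i := differentiable_coord_comp i df.
have daf i : differentiable (fun y => a y * f y ord0 i) x by exact: differentiableM.
apply/rowP => i; rewrite derive_coord; last first.
  apply: differentiable_rV => j; have := daf j; congr (differentiable _ _).
  by apply: funext => y; rewrite mxE.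
rewrite !mxE derive_coord // -derive_mul //; congr ('D_v _ x).
by apply: funext => y; rewrite mxE.
Qed.

Lemma smooth_on_dot m (W : set U) (f g : U -> 'rV[R]_m) : open W ->
  smooth_on W f -> smooth_on W g -> smooth_on W (fun x => dot (f x) (g x)).
Proof.
move=> oW fs gs; apply: smooth_on_sum => // i.
by apply: smooth_onM => //; exact: smooth_on_coord.
Qed.

Lemma smooth_onB m (W : set U) (f g : U -> 'rV[R]_m) : open W ->
  smooth_on W f -> smooth_on W g -> smooth_on W (fun x => f x - g x).
Proof.
move=> oW fs gs; apply: smooth_onD => //.
under eq_fun do rewrite -scaleN1r.
by apply: smooth_onZ => //; exact: smooth_on_cst.
Qed.

End DirectionalDerivative.

(** * Symmetry of second derivatives *)

Section Schwarz.
Context {R : realType} {V : normedModType R}.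
Implicit Types (f : V -> R) (x u v : V) (W : set V).

(** The left-hand side is the increment along s u of [g], itself the increment of f along s v. The
    mean value theorem is used twice, for [g] along u and for the derivative of f along v. *)
Lemma second_difference W f x u v (s : R) : open W -> smooth_on W f -> 0 < s ->
  (forall a b : R, 0 <= a <= s -> 0 <= b <= s -> W (x + a *: u + b *: v)) ->
  exists a b : R, [/\ 0 <= a <= s, 0 <= b <= s &
    f (x + s *: u + s *: v) - f (x + s *: u) - f (x + s *: v) + f x =
    s ^+ 2 * 'D_v ('D_u f) (x + a *: u + b *: v)].
Proof.
move=> oW fs s0 Ws; have s01 (t : R) : 0 <= t <= 1 -> 0 <= s * t <= s.
  by move=> /andP[t0 t1]; rewrite mulr_ge0 ?ler_piMr // ltW.
have s00 : 0 <= (0 : R) <= s by rewrite lexx ltW.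
have sss : 0 <= s <= s by rewrite lexx ltW.
pose g y := f (y + s *: v) - f y.
have dfW y : W y -> differentiable f y by exact: smooth_on_diff.
have dsh y : differentiable f (y + s *: v) ->
    is_diff y (fun z => f (z + s *: v)) ('d f (y + s *: v)).
  move=> df; have dT : is_diff y (fun z => z + s *: v) id.
    have -> : (fun z => z + s *: v) = id + cst (s *: v) by [].
    have dc : is_diff y (cst (s *: v) : V -> V) 0 by exact: is_diff_cst.
    have := is_diffD (is_diff_id y) dc; rewrite addr0; exact.
  have dfT : is_diff (y + s *: v) f ('d f (y + s *: v)) by exact: differentiableP.
  exact: is_diff_comp.
have W1 (t : R) : 0 <= t <= 1 -> W (x + t *: (s *: u)).
  move=> t01; have := Ws (s * t) 0 (s01 _ t01) s00.
  by rewrite scale0r addr0 scalerA mulrC.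
have W2 (t : R) : 0 <= t <= 1 -> W (x + t *: (s *: u) + s *: v).
  by move=> t01; have := Ws (s * t) s (s01 _ t01) sss; rewrite scalerA mulrC.
have dg (t : R) : 0 <= t <= 1 -> is_diff (x + t *: (s *: u)) g
    (('d f (x + t *: (s *: u) + s *: v) : V -> R) -
     ('d f (x + t *: (s *: u)) : V -> R)).
  move=> t01; have := dsh _ (dfW _ (W2 t t01)).
  have := differentiableP (dfW _ (W1 t t01)).
  by move=> ? ?; rewrite /g; exact: is_diffB.
have [c c01 gE] : exists2 c : R, 0 <= c <= 1 &
    g (x + s *: u) - g x = 'D_(s *: u) g (x + c *: (s *: u)).
  by apply: mean_value_line => t t01; have [] := dg t t01.
have D1 := smooth_on_derive (s *: u) fs.
have [d d01 DE] : exists2 d : R, 0 <= d <= 1 &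
    'D_(s *: u) f (x + c *: (s *: u) + s *: v) - 'D_(s *: u) f (x + c *: (s *: u))
    = 'D_(s *: v) ('D_(s *: u) f) (x + c *: (s *: u) + d *: (s *: v)).
  apply: (@mean_value_line R V ('D_(s *: u) f)) => t t01.
  apply: (smooth_on_diff D1).
  have := Ws (s * c) (s * t) (s01 _ c01) (s01 _ t01).
  by rewrite !scalerA !(mulrC s).
exists (s * c), (s * d); split; [exact: s01|exact: s01|].
have Wz : W (x + (s * c) *: u + (s * d) *: v) by apply: Ws; exact: s01.
transitivity (g (x + s *: u) - g x); first by rewrite /g opprB !addrA addrAC.
have [dgc dgE] := dg c c01.
rewrite gE (deriveE _ dgc) dgE.
have -> : (('d f (x + c *: (s *: u) + s *: v) : V -> R) -
     ('d f (x + c *: (s *: u)) : V -> R)) (s *: u) =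
  'd f (x + c *: (s *: u) + s *: v) (s *: u) -
  'd f (x + c *: (s *: u)) (s *: u) by [].
rewrite -(deriveE _ (dfW _ (W2 c c01))) -(deriveE _ (dfW _ (W1 c c01))).
rewrite DE !scalerA !(mulrC _ s).
transitivity (s *: 'D_v ('D_(s *: u) f) (x + (s * c) *: u + (s * d) *: v) : R).
  exact: deriveZdir (smooth_on_diff D1 Wz).
rewrite (_ : 'D_v ('D_(s *: u) f) _ =
    s * 'D_v ('D_u f) (x + (s * c) *: u + (s * d) *: v)).
  by rewrite /GRing.scale /= mulrA expr2.
have D2 := smooth_on_derive u fs.
rewrite (derive_ext (g := (s *: 'D_u f)) _ oW Wz); last first.
  by move=> y Wy; rewrite deriveZdir //; exact: dfW.
by rewrite deriveZ //; exact/diff_derivable/(smooth_on_diff D2).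
Qed.

(** The second difference is symmetric in u and v, so the two mixed derivatives take a common value
    at two points of any small parallelogram at x. By continuity they then cannot differ at x; [e]
    is half of the supposed gap. *)
Lemma Schwarz W f x u v : open W -> smooth_on W f -> W x ->
  'D_v ('D_u f) x = 'D_u ('D_v f) x.
Proof.
move=> oW fs Wx; apply/eqP; apply: contraT => neq.
move: neq; set A := 'D_v _ x; set B := 'D_u _ x => neq.
pose e := `|A - B| / 2.
have e0 : 0 < e by rewrite divr_gt0 // normr_gt0 subr_eq0.
have cA := smooth_on_continuous (smooth_on_derive v (smooth_on_derive u fs)) Wx.
have cB := smooth_on_continuous (smooth_on_derive u (smooth_on_derive v fs)) Wx.
have nA : \forall y \near x, `|A - 'D_v ('D_u f) y| < e.
  by apply: (proj1 (cvgrPdist_lt _ _) cA).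
have nB : \forall y \near x, `|B - 'D_u ('D_v f) y| < e.
  by apply: (proj1 (cvgrPdist_lt _ _) cB).
clearbody A B; have /nbhs_ballP[d d0 dP] : \forall y \near x, [/\ W y,
    `|A - 'D_v ('D_u f) y| < e & `|B - 'D_u ('D_v f) y| < e].
  have nW : nbhs x W by exact: (open_nbhs_nbhs (conj oW Wx)).
  by apply: filterS (filterI nW (filterI nA nB)) => y [? []].
(* With s = d / K the whole parallelogram lies in the ball of radius d; the summand 1 makes K
   positive and the inclusion strict. *)
pose K := `|u| + `|v| + 1.
have K0 : 0 < K by rewrite ltr_wpDl // addr_ge0.
pose s := d / K.
have s0 : 0 < s by exact: divr_gt0.
have sP (a b : R) : 0 <= a <= s -> 0 <= b <= s -> ball x d (x + a *: u + b *: v).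
  move=> /andP[a0 as_] /andP[b0 bs]; rewrite -ball_normE /ball_ /=.
  rewrite -addrA opprD addNKr normrN.
  apply: (le_lt_trans (ler_normD _ _)); rewrite !normrZ !ger0_norm //.
  apply: (@le_lt_trans _ _ (s * (`|u| + `|v|))).
    by rewrite mulrDr lerD // ler_wpM2r.
  rewrite /s -mulrA -ltr_pdivlMl // mulVf ?gt_eqF // mulrC ltr_pdivrMr //.
  by rewrite mul1r ltrDl.
have Wuv (a b : R) : 0 <= a <= s -> 0 <= b <= s -> W (x + a *: u + b *: v).
  by move=> ha hb; have [] := dP _ (sP a b ha hb).
have Wvu (a b : R) : 0 <= a <= s -> 0 <= b <= s -> W (x + a *: v + b *: u).
  by move=> ha hb; rewrite addrAC; exact: Wuv.
have [a [b [ha hb E1]]] := second_difference oW fs s0 Wuv.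
have [a' [b' [ha' hb' E2]]] := second_difference oW fs s0 Wvu.
have E : 'D_v ('D_u f) (x + a *: u + b *: v) =
    'D_u ('D_v f) (x + a' *: v + b' *: u).
  apply: (@mulfI _ (s ^+ 2)); first by rewrite expf_neq0 // gt_eqF.
  apply: (etrans (esym E1)); apply: (etrans _ E2).
  by rewrite (addrAC x) (addrAC (f _)).
have [_ h1 _] := dP _ (sP a b ha hb).
have := sP b' a' hb' ha'; rewrite addrAC => /dP[_ _ h2].
have : `|A - B| < e + e.
  apply: le_lt_trans (ltrD h1 h2).
  move: E; move: ('D_v _ (x + a *: u + b *: v)) ('D_u _ _) => p q ->.
  have -> : A - B = (A - q) - (B - q) by rewrite opprB addrA subrK.
  exact: ler_normB.
by rewrite -splitr ltxx.
Qed.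

End Schwarz.

(** * Derivatives in the direction of a variable vector field *)

Section Contraction.
Context {R : realType} {m : nat}.
Local Notation E := 'rV[R]_m.
Implicit Types (W : set E) (f : E -> R) (q u v : E).

Definition grad f (x : E) : E := \row_i 'D_(delta_mx ord0 i) f x.

Lemma derive_gradE f x v : differentiable f x -> 'D_v f x = dot v (grad f x).
Proof.
by move=> df; rewrite derive_basis //; apply: eq_bigr => i _; rewrite mxE.
Qed.

Lemma smooth_on_grad W f : open W -> smooth_on W f -> smooth_on W (grad f).
Proof.
move=> oW fs; apply: smooth_on_rV => // i; under eq_fun do rewrite mxE.
exact: smooth_on_derive.
Qed.

Lemma derive_dotr (U : normedModType R) (c : E) (g : U -> E) (x v : U) :
  differentiable g x -> 'D_v (fun y => dot c (g y)) x = dot c ('D_v g x).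
Proof.
move=> dg; rewrite (derive_dot (f := fun=> c)) //.
by rewrite derive_cst dot0l add0r.
Qed.

Lemma derive_grad W f q u v : open W -> smooth_on W f -> W q ->
  dot v ('D_u (grad f) q) = 'D_u ('D_v f) q.
Proof.
move=> oW fs Wq; have gs := smooth_on_grad oW fs.
rewrite -derive_dotr; last exact: smooth_on_diff gs Wq.
apply: (derive_ext _ oW Wq) => y Wy.
by rewrite derive_gradE //; exact: smooth_on_diff fs Wy.
Qed.

Lemma smooth_on_contract W f (Y : E -> E) : open W -> smooth_on W f ->
  smooth_on W Y -> smooth_on W (fun x => 'D_(Y x) f x).
Proof.
move=> oW fs Ys; have := smooth_on_dot oW Ys (smooth_on_grad oW fs).
apply: smooth_on_ext => // x Wx.
by rewrite derive_gradE //; exact: smooth_on_diff fs Wx.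
Qed.

(** Leibniz rule for df(Y), with df written through the gradient. In the last term Y is frozen at q,
    so that this term is the Hessian of f on (u, Y q). *)
Lemma derive_contract W f (Y : E -> E) q u : open W -> smooth_on W f ->
  smooth_on W Y -> W q ->
  'D_u (fun x => 'D_(Y x) f x) q = 'D_('D_u Y q) f q + 'D_u ('D_(Y q) f) q.
Proof.
move=> oW fs Ys Wq; have gs := smooth_on_grad oW fs.
have df := smooth_on_diff fs Wq.
rewrite (derive_gradE _ df) -(derive_grad u (Y q) oW fs Wq).
have := derive_dot u (smooth_on_diff Ys Wq) (smooth_on_diff gs Wq).
move=> <-; apply: (derive_ext _ oW Wq) => y Wy.
by rewrite derive_gradE //; exact: smooth_on_diff fs Wy.
Qed.

Lemma smooth_on_contract_rV l W (f : E -> 'rV[R]_l) (Y : E -> E) : open W ->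
  smooth_on W f -> smooth_on W Y -> smooth_on W (fun x => 'D_(Y x) f x).
Proof.
move=> oW fs Ys; apply: smooth_on_rV => // i.
have := smooth_on_contract oW (smooth_on_coord i oW fs) Ys.
apply: smooth_on_ext => // x Wx.
by rewrite derive_coord //; exact: smooth_on_diff fs Wx.
Qed.

Lemma derive_contract_rV l W (f : E -> 'rV[R]_l) (Y : E -> E) q u : open W ->
  smooth_on W f -> smooth_on W Y -> W q ->
  'D_u (fun x => 'D_(Y x) f x) q = 'D_('D_u Y q) f q + 'D_u ('D_(Y q) f) q.
Proof.
move=> oW fs Ys Wq; apply/rowP => i; rewrite mxE.
have df := smooth_on_diff fs Wq.
have sc := smooth_on_contract_rV oW fs Ys.
have sd := smooth_on_derive (Y q) fs.
have fis := smooth_on_coord i oW fs.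
apply: (etrans (derive_coord u i (smooth_on_diff sc Wq))).
have h1 y : W y -> ('D_(Y y) f y) ord0 i = 'D_(Y y) (fun z => f z ord0 i) y.
  by move=> Wy; exact: derive_coord (smooth_on_diff fs Wy).
apply: (etrans (derive_ext u oW Wq h1)).
apply: (etrans (derive_contract u oW fis Ys Wq)).
congr (_ + _); first exact/esym/(derive_coord _ i df).
apply/esym/(etrans (derive_coord u i (smooth_on_diff sd Wq))).
apply: (derive_ext _ oW Wq) => y Wy.
exact: derive_coord (smooth_on_diff fs Wy).
Qed.

Lemma Schwarz_rV l W (f : E -> 'rV[R]_l) x u v : open W -> smooth_on W f ->
  W x -> 'D_v ('D_u f) x = 'D_u ('D_v f) x.
Proof.
move=> oW fs Wx; apply/rowP => i.
have du := smooth_on_diff (smooth_on_derive u fs) Wx.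
have dv := smooth_on_diff (smooth_on_derive v fs) Wx.
have h w y : W y -> ('D_w f y) ord0 i = 'D_w (fun z => f z ord0 i) y.
  by move=> Wy; exact: derive_coord (smooth_on_diff fs Wy).
apply: (etrans (derive_coord v i du)); apply/esym.
apply: (etrans (derive_coord u i dv)).
apply: (etrans (derive_ext u oW Wx (h v))).
apply: (etrans (Schwarz v u oW (smooth_on_coord i oW fs) Wx)).
exact/esym/(derive_ext v oW Wx (h u)).
Qed.

End Contraction.

(** * The Poincare lemma on a ball *)

Section Poincare.
Context {R : realType}.

(** The segment [0, 1] is placed in the interior of a compact interval [a', b'], so that the
    fundamental theorem gives two-sided derivatives at 0 and 1 as well. *)
Lemma primitive_exists (f : R -> R) (a b : R) : a < 0 -> 1 < b ->
  (forall t : R, a < t < b -> {for t, continuous f}) ->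
  exists P : R -> R, forall t : R, 0 <= t <= 1 -> is_derive t 1 P (f t).
Proof.
move=> a0 b1 fc; pose a' := a / 2; pose b' := (1 + b) / 2.
have [aa' a'0] : a < a' /\ a' < 0 by rewrite /a'; lra.
have [b'1 bb'] : 1 < b' /\ b' < b by rewrite /b'; lra.
have fi : lebesgue_measure.-integrable `[a', b'] (EFin \o f).
  apply: continuous_compact_integrable; first exact: segment_compact.
  apply: continuous_in_subspaceT => t; rewrite inE /= in_itv /= => /andP[at_ tb].
  by apply: fc; rewrite (lt_le_trans aa' at_) (le_lt_trans tb bb').
eexists => t /andP[t0 t1].
have tb' : t < b' by exact: le_lt_trans t1 b'1.
have at_ : a' < t by exact: lt_le_trans a'0 t0.
have ft : {for t, continuous f}.
  by apply: fc; rewrite (lt_trans aa' at_) (lt_trans tb' bb').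
have [d D] := continuous_FTC1_closed tb' fi at_ ft.
by apply: DeriveDef; [exact: d|rewrite -derive1E D].
Qed.

(** Compactness of [0, 1] makes the estimate uniform in t; g is only known to be continuous at the
    points of the segment. *)
Lemma continuous_near_segment {V : normedModType R} (g : V -> R) (p y : V)
    (e : R) : 0 < e ->
  (forall t : R, 0 <= t <= 1 -> {for p + t *: y, continuous g}) ->
  \forall k \near (0 : V), forall t : R, 0 <= t <= 1 ->
    `|g (p + t *: y + k) - g (p + t *: y)| < e.
Proof.
move=> e0 gc.
have /compact_near_coveringP cov := @segment_compact R 0 1.
have := cov V (nbhs (0 : V)) (fun k (t : R) =>
  `|g (p + t *: y + k) - g (p + t *: y)| < e) _.
suff K : forall t : R, `[0, 1]%classic t -> \forall s \near t & k \near (0 : V),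
    `|g (p + s *: y + k) - g (p + s *: y)| < e.
  move=> /(_ _ K); apply: filterS => k H t t01; apply: H.
  by rewrite /= in_itv.
move=> t; rewrite /= in_itv /= => t01.
have nz : \forall z \near p + t *: y, `|g (p + t *: y) - g z| < e / 2.
  by apply: (proj1 (cvgrPdist_lt _ _) (gc t t01)); rewrite divr_gt0.
have c1 : ((fun s : R => p + s *: y) @ t --> p + t *: y).
  by apply: cvgD; [exact: cvg_cst|apply: cvgZr_tmp; exact: cvg_id].
have c2 : ((fun z : R * V => p + z.1 *: y + z.2) @ (t, 0 : V) --> p + t *: y).
  rewrite -[X in _ --> X]addr0; apply: cvgD; last exact: cvg_snd.
  by apply: (cvg_comp _ _ _ c1); exact: cvg_fst.
have n1 := c1 _ nz; have n2 := c2 _ nz.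
have n1' : \forall s \near t & k \near (0 : V),
    `|g (p + t *: y) - g (p + s *: y)| < e / 2.
  exists ([set s : R | `|g (p + t *: y) - g (p + s *: y)| < e / 2], [set: V]).
    by split => //; exact: filterT.
  by move=> [s k] [].
apply: filterS (filterI n1' n2) => -[s k] /= [h1 h2].
rewrite [e]splitr; apply: le_lt_trans (ltrD h1 h2).
move: (g (p + t *: y)) (g (p + s *: y)) (g _) => G b c.
have -> : c - b = (G - b) - (G - c) by ring.
exact: ler_normB.
Qed.

End Poincare.

Section PoincareBall.
Context {R : realType} {m : nat}.
Local Notation E := 'rV[R]_m.
Variables (p : E) (rho : R) (w : E -> E).
Local Notation B := (ball p rho).
Hypothesis ws : smooth_on B w.
Hypothesis wclosed : forall x u v, B x -> dot u ('D_v w x) = dot v ('D_u w x).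

Let oB : open B. Proof. exact: ball_open. Qed.

Let dw z : B z -> differentiable w z. Proof. exact: smooth_on_diff. Qed.

Let inB y : `|y| < rho -> B (p + y).
Proof. by move=> h; rewrite -ball_normE /ball_ /= opprD addNKr normrN. Qed.

Let segB y (t : R) : `|y| < rho -> 0 <= t <= 1 -> B (p + t *: y).
Proof.
move=> yr /andP[t0 t1]; apply: inB; rewrite normrZ ger0_norm //.
by apply: le_lt_trans yr; rewrite ler_piMl.
Qed.

Lemma radial_primitive y : `|y| < rho -> exists P : R -> R,
  forall t : R, 0 <= t <= 1 -> is_derive t 1 P (dot y (w (p + t *: y))).
Proof.
move=> yr; have rho0 : 0 < rho by exact: le_lt_trans (normr_ge0 y) yr.
(* This margin gives (1 + d) |y| <= |y| + d rho = rho, so the segment may be prolonged by d at both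
   ends inside the ball. *)
pose d := (rho - `|y|) / rho.
have d0 : 0 < d by rewrite divr_gt0 // subr_gt0.
have dB (t : R) : - d < t < 1 + d -> B (p + t *: y).
  move=> /andP[t1 t2]; apply: inB; rewrite normrZ.
  have tl : `|t| < 1 + d by rewrite ltr_norml t2 andbT; lra.
  have [y0|y0] := eqVneq (`|y|) 0; first by rewrite y0 mulr0.
  have yp : 0 < `|y| by rewrite lt_neqAle eq_sym y0 normr_ge0.
  apply: (@lt_le_trans _ _ ((1 + d) * `|y|)); first by rewrite ltr_pM2r.
  rewrite mulrDl mul1r -lerBrDl /d mulrAC ler_pdivrMr //.
  by apply: ler_wpM2l; rewrite ?subr_ge0 ltW.
apply: (@primitive_exists R (fun t => dot y (w (p + t *: y))) (- d) (1 + d)).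
- by rewrite oppr_lt0.
- by rewrite ltrDl.
move=> t td; apply/differentiable_continuous/derivable1_diffP.
have s : smooth_on B (fun z => dot y (w z)).
  by apply: smooth_on_dot => //; exact: smooth_on_cst.
by have [] := is_derive_along (smooth_on_diff s (dB t td)).
Qed.

Let w_coord j := fun z : E => w z ord0 j.

(* By closedness t * dot h (D_y w) = t * dot y (D_h w): the integrand of the
   radial primitive varies to first order as the t-derivative of
   t * dot h (w (p + t y)), uniformly in t. *)
Lemma radial_increment y (e : R) : `|y| < rho -> 0 < e ->
  \forall h \near (0 : E), forall t : R, 0 <= t <= 1 ->
    `|dot (y + h) (w (p + t *: (y + h))) - dot y (w (p + t *: y))
      - (dot h (w (p + t *: y)) + t * dot h ('D_y w (p + t *: y)))|
    <= e * `|h|.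
Proof.
move=> yr e0.
have ycB (t : R) : 0 <= t <= 1 -> B (p + t *: y) by exact: segB.
(* The two error terms are at most m |y| m |h| e' and m |h| e'; K is the sum of their coefficients,
   plus 1 to be positive. *)
pose K := m%:R * `|y| * m%:R + m%:R + 1 : R.
have K0 : 0 < K by rewrite ltr_wpDl // addr_ge0 // !mulr_ge0.
pose e' := e / K.
have e'0 : 0 < e' by exact: divr_gt0.
have ws_ j : smooth_on B (w_coord j) by exact: smooth_on_coord.
have gs_ j : smooth_on B (grad (w_coord j)) by exact: smooth_on_grad.
have gs__ i j : smooth_on B (fun z => grad (w_coord j) z ord0 i).
  exact: smooth_on_coord.
pose near_seg (g : E -> R) (k : E) := forall t : R, 0 <= t <= 1 ->
  `|g (p + t *: y + k) - g (p + t *: y)| < e'.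
have N1 : \forall k \near (0 : E), forall j, near_seg (w_coord j) k.
  have FF : Filter (nbhs (0 : E)) by exact: nbhs_filter.
  apply: (@filter_forall E _ (fun j => near_seg (w_coord j))
    (nbhs (0 : E)) FF) => j.
  apply: (@continuous_near_segment R E (w_coord j) p y e' e'0) => t t01.
  exact: smooth_on_continuous (ws_ j) (ycB t t01).
have N2 : \forall k \near (0 : E), forall ij : 'I_m * 'I_m,
    near_seg (fun z => grad (w_coord ij.2) z ord0 ij.1) k.
  have FF : Filter (nbhs (0 : E)) by exact: nbhs_filter.
  apply: (@filter_forall E _ (fun ij : 'I_m * 'I_m =>
    near_seg (fun z => grad (w_coord ij.2) z ord0 ij.1)) (nbhs (0 : E)) FF) => ij.
  apply: (@continuous_near_segment R E _ p y e' e'0) => t t01.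
  by exact: smooth_on_continuous (gs__ ij.1 ij.2) (ycB t t01).
have N3 : \forall k \near (0 : E), `|k| < rho - `|y|.
  by apply: nbhs0_lt; rewrite subr_gt0.
have [d d0 dP] := (@nbhs_ballP R E (0 : E) _).1 (filterI N1 (filterI N2 N3)).
apply/(@nbhs_ballP R E (0 : E) _); exists d => // h.
rewrite -ball_normE /ball_ /= sub0r normrN => hd.
have hP (s : R) : 0 <= s <= 1 -> ball (0 : E) d (s *: h).
  move=> /andP[s0 s1]; rewrite -ball_normE /ball_ /= sub0r normrN normrZ.
  by rewrite ger0_norm //; apply: le_lt_trans hd; rewrite ler_piMl.
move=> t t01; have [t0 t1] := andP t01.
set z := p + t *: y.
have zB (s : R) : 0 <= s <= 1 -> B (z + s *: (t *: h)).
  move=> s01; have [s0 s1] := andP s01.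
  have -> : z + s *: (t *: h) = p + t *: (y + s *: h).
    by rewrite scalerDr addrA !scalerA (mulrC s).
  apply: segB => //; apply: (le_lt_trans (ler_normD _ _)).
  by have [_ [_]] := dP _ (hP s s01); rewrite ltrBrDl.
have z0B : B z by exact: ycB.
pose F := fun x => dot y (w x).
have Fs : smooth_on B F by apply: smooth_on_dot => //; exact: smooth_on_cst.
have [c c01 cE] : exists2 c : R, 0 <= c <= 1 &
    F (z + t *: h) - F z = 'D_(t *: h) F (z + c *: (t *: h)).
  by apply: mean_value_line => s s01; exact: smooth_on_diff Fs (zB s s01).
have ct01 : 0 <= c * t <= 1.
  have [c0 c1] := andP c01; rewrite mulr_ge0 //=.
  by apply: (le_trans _ t1); rewrite ler_piMl.
set z' := z + c *: (t *: h) in cE.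
have z'B : B z' by exact: zB.
have FE : 'D_(t *: h) F z' = t * dot y ('D_h w z').
  rewrite (derive_dotr y (t *: h) (dw z'B)) (deriveZdir t h (dw z'B)).
  by rewrite dotC dotZl dotC.
have D1 j : `|('D_h w z' - 'D_h w z) ord0 j| <= m%:R * `|h| * e'.
  rewrite !mxE (derive_coord h j (dw z'B)) (derive_coord h j (dw z0B)).
  rewrite (derive_gradE h (smooth_on_diff (ws_ j) z'B)).
  rewrite (derive_gradE h (smooth_on_diff (ws_ j) z0B)) -dotBr.
  apply: dot_le => i; rewrite !mxE ltW //.
  have [_ [+ _]] := dP _ (hP _ ct01).
  by move=> /(_ (i, j) t t01); rewrite -scalerA !mxE.
have D2 j : `|(w (z + t *: h) - w z) ord0 j| <= e'.
  rewrite !mxE ltW //; have [+ _] := dP _ (hP _ t01).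
  by move=> /(_ j t t01).
have -> : p + t *: (y + h) = z + t *: h by rewrite scalerDr addrA.
rewrite (wclosed h y z0B) dotDl.
have -> : dot y (w (z + t *: h)) = t * dot y ('D_h w z') + dot y (w z).
  by rewrite -FE -cE subrK.
have -> : t * dot y ('D_h w z') + dot y (w z) + dot h (w (z + t *: h)) -
    dot y (w z) - (dot h (w z) + t * dot y ('D_h w z)) =
    t * dot y ('D_h w z' - 'D_h w z) + dot h (w (z + t *: h) - w z).
  by rewrite !dotBr; move: (dot _ _) (dot _ _) (dot _ _) (dot _ _) => *; ring.
have b1 := dot_le y D1; have b2 := dot_le h D2.
apply: (le_trans (ler_normD _ _)).
apply: (@le_trans _ _ (m%:R * `|y| * (m%:R * `|h| * e') + m%:R * `|h| * e')).
  apply: lerD => //; rewrite normrM ger0_norm //; apply: le_trans b1.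
  by rewrite ler_piMl.
have -> : m%:R * `|y| * (m%:R * `|h| * e') + m%:R * `|h| * e' =
    (m%:R * `|y| * m%:R + m%:R) * e' * `|h| by ring.
rewrite ler_wpM2r // /e' mulrA ler_pdivrMr // mulrC ler_wpM2l ?ltW //.
by rewrite ltrDl.
Qed.

(** The potential is the integral over [0, 1] of the radial integrand. It is not differentiated
    under the integral sign: its remainder at x is an increment of [Q] over [0, 1], and the mean
    value theorem reduces it to the bound of [radial_increment]. *)
Lemma poincare_ball : exists phi : E -> R, forall x, B x ->
  differentiable phi x /\ forall v, 'D_v phi x = dot v (w x).
Proof.
(* One primitive is chosen for each y; its additive constant disappears in the difference defining
   [phi]. *)
have /choice[P PE] : forall y, exists P : R -> R, `|y| < rho ->
    forall t : R, 0 <= t <= 1 -> is_derive t 1 P (dot y (w (p + t *: y))).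
  move=> y; have [yr|yr] := boolP (`|y| < rho); last by exists (fun=> 0).
  by have [P PE] := radial_primitive yr; exists P.
pose phi x := P (x - p) 1 - P (x - p) 0.
exists phi => x Bx; pose y := x - p.
have yr : `|y| < rho by move: Bx; rewrite -ball_normE /ball_ /= distrC.
have dL z : differentiable (fun u => dot u (w x)) z.
  have := smooth_on_dot openT (@smooth_on_id _ _ setT)
    (@smooth_on_cst _ _ _ setT (w x)).
  by move=> /smooth_on_diff; exact.
(* [L] is the map u |-> dot u (w x) itself, taken as its own differential in order to have it as a
   continuous linear map. *)
pose L := 'd (fun u => dot u (w x)) (0 : E).
have LE v : L v = dot v (w x).
  rewrite /L -(deriveE v (dL 0)) (derive_dot (f := id) (g := fun=> w x)) //.
  by rewrite derive_id derive_cst dot0r addr0.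
have [|e e0|dphi phiE] := @differentiable_approx R _ _ phi x L.
- exact: diff_continuous.
- have N1 := radial_increment yr e0.
  have N3 : \forall k \near (0 : E), `|k| < rho - `|y|.
    by apply: nbhs0_lt; rewrite subr_gt0.
  apply: filterS (filterI N1 N3) => h [hE hr]; rewrite LE.
  have yhr : `|y + h| < rho.
    by apply: (le_lt_trans (ler_normD _ _)); rewrite -ltrBrDl.
  pose G (t : R) := dot h (w (p + t *: y)).
  pose dG (t : R) := dot h ('D_y w (p + t *: y)).
  have GE (t : R) : 0 <= t <= 1 -> is_derive t 1 G (dG t).
    move=> t01; have Bt := segB yr t01.
    have s : smooth_on B (fun z => dot h (w z)).
      by apply: smooth_on_dot => //; exact: smooth_on_cst.
    have := is_derive_along (smooth_on_diff s Bt).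
    by rewrite derive_dotr //; exact: dw.
  (* As t G(t) goes from 0 to dot h (w x), the increment of [Q] is exactly the remainder of the
     expansion of [phi] at x. *)
  pose Q (t : R) := P (y + h) t - P y t - t * G t.
  pose dQ (t : R) := dot (y + h) (w (p + t *: (y + h))) - dot y (w (p + t *: y))
      - (G t + t * dG t).
  have QE (t : R) : 0 <= t <= 1 -> is_derive t 1 Q (dQ t).
    move=> t01; have d1 := PE (y + h) yhr t t01; have d2 := PE y yr t t01.
    have d3 := GE t t01; have d4 := is_derive_id t (1 : R).
    have d5 := is_deriveM d4 d3; have d12 := is_deriveB d1 d2.
    have := is_deriveB d12 d5; congr (is_derive _ _ _ _).
    by rewrite /dQ /GRing.scale /=; ring.
  have [c] : exists2 c : R, c \in `]0, 1[%R & Q 1 - Q 0 = dQ c * (1 - 0).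
    apply: (@MVT R Q dQ) => // [t|].
      by rewrite in_itv /= => /andP[t0 t1]; apply: QE; rewrite !ltW.
    apply: derivable_within_continuous => t; rewrite in_itv /= => t01.
    by have [] := QE t t01.
  rewrite in_itv /= subr0 mulr1 => /andP[c0 c1] QQ.
  have -> : phi (h + x) - phi x - dot h (w x) = Q 1 - Q 0.
    have hx : h + x - p = y + h by rewrite -addrA addrC.
    have py : p + 1 *: y = x by rewrite scale1r addrC subrK.
    rewrite /phi /Q /G mul0r mul1r py hx -/y subr0 !opprB.
    by move: (dot h _) (P _ 1) (P y 1) (P _ 0) (P y 0) => *; ring.
  by rewrite QQ; apply: hE; rewrite !ltW.
split; first exact: dphi.
by move=> v; rewrite (deriveE v dphi) phiE LE.
Qed.

End PoincareBall.

(** * Submanifolds *)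

Lemma open_preimage_on (R : realType) (U A : normedModType R) (V : set U)
  (O : set A) (f : U -> A) : open V -> open O ->
  (forall x, V x -> {for x, continuous f}) -> open (V `&` [set x | O (f x)]).
Proof.
move=> oV oO fc; rewrite openE => x [Vx Ox]; rewrite /interior; apply: filterI.
  exact: (open_nbhs_nbhs (conj oV Vx)).
apply: (fc x Vx); exact: (open_nbhs_nbhs (conj oO Ox)).
Qed.

(** * Curves in a subset and derivatives along it *)

Section Curves.
Context {R : realType} {n : nat}.
Local Notation E := 'rV[R]_n.+2.
Implicit Types (S W O : set E) (p q v w : E).

Lemma is_derive_unique (V : normedModType R) (f : R -> V) (t : R) (a b : V) :
  is_derive t 1 f a -> is_derive t 1 f b -> a = b.
Proof. by move=> da db; rewrite -(derive_val (is_derive := da)) derive_val. Qed.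

Lemma open_line (V : normedModType R) (W : set V) (q v : V) : open W -> W q ->
  exists2 e : R, 0 < e & forall t : R, t \in `]- e, e[ -> W (q + t *: v).
Proof.
move=> oW Wq; have nW : nbhs q W by exact: (open_nbhs_nbhs (conj oW Wq)).
have c : ((fun s : R => q + s *: v) @ (0 : R) --> q).
  rewrite -[X in _ --> X]addr0 -(scale0r v).
  by apply: cvgD; [exact: cvg_cst|apply: cvgZr_tmp; exact: cvg_id].
have [e /= e0 eP] := (@nbhs_ballP R R (0 : R) _).1 (c _ nW).
exists e => // t; rewrite in_itv /= => /andP[t1 t2]; apply: eP.
by rewrite -ball_normE /ball_ /= sub0r normrN ltr_norml t1.
Qed.

Lemma curve_in_sub S S' p v gamma : S `<=` S' ->
  curve_in S p v gamma -> curve_in S' p v gamma.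
Proof.
by move=> SS' [e e0 [gs gS g0 dg]]; exists e => //; split=> // t /gS/SS'.
Qed.

Lemma curve_in_open S O p v gamma : open O -> O p ->
  curve_in S p v gamma -> curve_in (S `&` O) p v gamma.
Proof.
move=> oO Op [e e0 [gs gS g0 dg]].
have Og : O (gamma 0) by rewrite g0.
have nO : nbhs (gamma 0) O by exact: (open_nbhs_nbhs (conj oO Og)).
have gc : {for (0 : R), continuous gamma}.
  by apply/differentiable_continuous/derivable1_diffP; case: dg.
have [d /= d0 dP] := (@nbhs_ballP R R (0 : R) _).1 (gc _ nO).
pose m := Num.min e d; exists m; first by rewrite lt_min e0.
have sub (t : R) : t \in `]- m, m[ -> (t \in `]- e, e[) /\ (t \in `]- d, d[).
  by rewrite !in_itv /= -!ltr_norml lt_min => /andP.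
split => //.
  by apply: smooth_on_sub gs => t /= /sub[].
move=> t /sub[te td]; split; first exact: gS.
apply: dP; rewrite -ball_normE /ball_ /= sub0r normrN.
by move: td; rewrite in_itv /= -ltr_norml.
Qed.

Lemma tangent_setI S O p v : open O -> O p ->
  tangent (S `&` O) p v <-> tangent S p v.
Proof.
move=> oO Op; split=> -[g gc]; exists g; last exact: curve_in_open.
by apply: curve_in_sub gc => x [].
Qed.

Lemma tangent_image S W q v (g : E -> E) : open W -> W q -> smooth_on W g ->
  (forall t : R, W (q + t *: v) -> S (g (q + t *: v))) ->
  tangent S (g q) ('D_v g q).
Proof.
move=> oW Wq gs gS; have [e e0 eP] := open_line v oW Wq.
exists (fun t => g (q + t *: v)); exists e => //; split.
- have oI : open `]- e, e[%classic by exact: interval_open.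
  apply: (@smooth_on_comp _ _ _ _ _ W g (fun t : R => q + t *: v)) => //.
  apply: smooth_onD => //; first exact: smooth_on_cst.
  by apply: smooth_onZ => //; [exact: smooth_on_id|exact: smooth_on_cst].
- by move=> t /eP; exact: gS.
- by rewrite scale0r addr0.
- have := @is_derive_along _ _ _ g q v 0; rewrite scale0r addr0; apply.
  exact: smooth_on_diff gs Wq.
Qed.

(** Near the parameter 0 the curve stays in S and in W, where f and its extension g agree; only the
    velocity of the curve is left. *)
Lemma is_derive_curve (V : normedModType R) S W p v gamma (f g : E -> V) :
  curve_in S p v gamma -> open W -> W p -> smooth_on W g ->
  (forall x, W x -> S x -> g x = f x) ->
  is_derive (0 : R) (1 : R) (f \o gamma) ('D_v g p).
Proof.
move=> gc oW Wp gs gf; have [e e0 [_ gS g0 dg]] := curve_in_open oW Wp gc.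
have dgp : differentiable g (gamma 0) by rewrite g0; exact: smooth_on_diff gs Wp.
have := is_derive_comp_diff dgp dg; rewrite g0.
apply: near_eq_is_derive; near=> t.
have /gS[] : t \in `]- e, e[.
  by near: t; apply: near_in_itvoo; rewrite in_itv /= oppr_lt0 e0.
by move=> St Wt; rewrite /= gf.
Unshelve. all: by end_near. Qed.

(** All curves with velocity v give the same derivative, so the choice made in [flatD] is harmless
    and any local smooth extension computes it. *)
Lemma flatDE S W p v (f g : E -> E) : tangent S p v -> open W -> W p ->
  smooth_on W g -> (forall x, W x -> S x -> g x = f x) ->
  flatD S f p v = 'D_v g p.
Proof.
move=> [gamma gc] oW Wp gs gf; rewrite /flatD; case: xgetP.
  move=> w _ [g1 [g1c dw]].
  exact: is_derive_unique dw (is_derive_curve g1c oW Wp gs gf).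
move=> /(_ ('D_v g p)) []; exists gamma; split => //.
exact: is_derive_curve gc oW Wp gs gf.
Qed.

End Curves.

(** * Tangent spaces and retractions in slice charts *)

Section Charts.
Context {R : realType} {n : nat}.
Local Notation E := 'rV[R]_n.+2.
Variables (k : nat) (S W W' : set E) (Phi Psi : E -> E).
Hypotheses (oW : open W) (oW' : open W').
Hypotheses (Phis : smooth_on W Phi) (Psis : smooth_on W' Psi).
Hypothesis PhiK : forall x, W x -> W' (Phi x) /\ Psi (Phi x) = x.
Hypothesis PsiK : forall y, W' y -> W (Psi y) /\ Phi (Psi y) = y.
Hypothesis PhiS : forall x, W x ->
  (S x <-> forall i : 'I_n.+2, (k <= i)%N -> Phi x ord0 i = 0).

Lemma derive_PsiPhi q v : W q -> 'D_('D_v Phi q) Psi (Phi q) = v.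
Proof.
move=> Wq; have [W'q _] := PhiK Wq.
have := derive_compE v (smooth_on_diff Phis Wq) (smooth_on_diff Psis W'q).
move=> <-; rewrite -[RHS](derive_id q v); apply: (derive_ext _ oW Wq) => y Wy.
by have [] := PhiK Wy.
Qed.

Lemma derive_PhiPsi q v : W q -> 'D_('D_v Psi (Phi q)) Phi q = v.
Proof.
move=> Wq; have [W'q Kq] := PhiK Wq.
have Wq' : W (Psi (Phi q)) by rewrite Kq.
have := derive_compE v (smooth_on_diff Psis W'q) (smooth_on_diff Phis Wq').
rewrite Kq => <-; rewrite -[RHS](derive_id (Phi q) v).
apply: (derive_ext _ oW' W'q) => y Wy.
by have [] := PsiK Wy.
Qed.

(** The coordinates of Phi of index >= k vanish along curves in S. Conversely, Psi maps into S the
    line through Phi q in the direction D_v Phi q, which stays in the slice. *)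
Lemma tangent_chart q v : W q -> S q ->
  tangent S q v <-> forall i : 'I_n.+2, (k <= i)%N -> ('D_v Phi q) ord0 i = 0.
Proof.
move=> Wq Sq; split.
  move=> [gamma gc] i ki.
  have s := smooth_on_coord i oW Phis.
  have dPhi := @is_derive_curve R n R S W q v gamma (fun=> 0) _ gc oW Wq s.
  rewrite (derive_coord _ _ (smooth_on_diff Phis Wq)).
  apply: is_derive_unique (dPhi _) _; last exact: is_derive_cst.
  by move=> x Wx /(PhiS Wx); apply.
move=> v0; have [W'q Kq] := PhiK Wq.
have := @tangent_image R n S W' (Phi q) ('D_v Phi q) Psi oW' W'q Psis.
rewrite derive_PsiPhi // Kq; apply => t Wt.
have [Wt' Kt] := PsiK Wt; apply/(PhiS Wt') => i ki.
by rewrite Kt !mxE v0 // mulr0 addr0; exact: (PhiS Wq).1.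
Qed.

Definition slice_proj (y : E) : E := \row_i if (i < k)%N then y ord0 i else 0.

Lemma smooth_on_slice_proj (O : set E) : open O -> smooth_on O slice_proj.
Proof.
move=> oO; apply: smooth_on_rV => // i; under eq_fun do rewrite mxE.
case: (i < k)%N; last exact: smooth_on_cst.
by apply: smooth_on_coord => //; exact: smooth_on_id.
Qed.

(** Read in the chart, the retraction is the projection onto the slice; [W1] consists of the points
    whose projection remains in the image W' of the chart. *)
Lemma chart_retraction : exists (W1 : set E) (r : E -> E),
  [/\ open W1, W1 `<=` W, W `&` S `<=` W1 & smooth_on W1 r] /\
  (forall x, W1 x -> S (r x) /\ W1 (r x)) /\
  (forall x, W1 x -> S x -> r x = x).
Proof.
pose g x := slice_proj (Phi x).
pose W1 := W `&` [set x | W' (g x)].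
have gs : smooth_on W g.
  exact: (smooth_on_comp oW openT _ (@smooth_on_slice_proj setT openT) Phis).
have oW1 : open W1.
  exact: open_preimage_on oW oW' (fun x => smooth_on_continuous gs).
have gS x : W x -> S x -> g x = Phi x.
  move=> Wx Sx; apply/rowP => i; rewrite mxE; case: ltnP => // ki.
  by rewrite ((PhiS Wx).1 Sx).
have gg x : W1 x -> [/\ W (Psi (g x)), g (Psi (g x)) = g x & S (Psi (g x))].
  move=> [Wx W'x]; have [Wr Kr] := PsiK W'x; split => //.
    rewrite /g Kr; apply/rowP => i; rewrite !mxE.
    by case: ifP => // ->.
  apply/(PhiS Wr) => i ki; rewrite Kr mxE.
  by rewrite ltnNge ki.
exists W1, (Psi \o g); split; [split=> //|split].
- by move=> x [].
- by move=> x [Wx Sx]; split => //=; rewrite gS //; have [] := PhiK Wx.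
- apply: (smooth_on_comp oW1 oW' _ Psis); first by move=> x [].
  by apply: smooth_on_sub gs => x [].
- move=> x W1x; have [? ge ?] := gg x W1x; split => //; split=> //=.
  by rewrite ge; case: W1x.
- by move=> x [Wx _] Sx /=; rewrite gS //; have [] := PhiK Wx.
Qed.

End Charts.

(** * A retraction onto N together with an equation of M *)

Section Adapted.
Context {R : realType} {n : nat}.
Local Notation E := 'rV[R]_n.+2.
Implicit Types (M N W : set E) (r : E -> E) (F : E -> R).

(* T_q N is the space of fixed vectors of the differential at q of the
   retraction r. [adapted_decomp] says that N has codimension 1 in M. *)
Record adapted M N W r F : Prop := Adapted {
  adapted_open : open W;
  adapted_sub : N `<=` M;
  adapted_retr : smooth_on W r;
  adapted_eqn : smooth_on W F;
  adapted_im : forall x, W x -> N (r x) /\ W (r x);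
  adapted_fix : forall x, W x -> N x -> r x = x;
  adapted_tangentM : forall q v, W q -> N q ->
    tangent M q v <-> 'D_v F q = 0;
  adapted_decomp : forall q xi v, W q -> N q -> tangent M q xi ->
    ~ tangent N q xi -> tangent M q v -> exists c : R, tangent N q (v - c *: xi) }.

Lemma tangent_sub N M q v : N `<=` M -> tangent N q v -> tangent M q v.
Proof. by move=> NM [g gc]; exists g; exact: curve_in_sub NM gc. Qed.

(** The linear form (a, b) on the plane takes the value 1, so its kernel is a line: the determinant
    of two kernel vectors vanishes, and (s, t) is nonzero. The plane will be the quotient of the
    ambient space by T_q N. *)
Lemma proportional_solutions (a b c d s t s' t' : R) : a * c + b * d = 1 ->
  a * s + b * t = 0 -> a * s' + b * t' = 0 -> ~ (s = 0 /\ t = 0) ->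
  exists k : R, s' = k * s /\ t' = k * t.
Proof.
move=> cd st st' nz.
have det0 : s * t' - s' * t = 0.
  have h1 : a * (s * t' - s' * t) = 0.
    have -> : a * (s * t' - s' * t) =
      (a * s + b * t) * t' - (a * s' + b * t') * t by ring.
    by rewrite st st' !mul0r subrr.
  have h2 : b * (s * t' - s' * t) = 0.
    have -> : b * (s * t' - s' * t) =
      (a * s' + b * t') * s - (a * s + b * t) * s' by ring.
    by rewrite st st' !mul0r subrr.
  rewrite -[LHS]mul1r -cd mulrDl.
  by rewrite mulrAC h1 (mulrAC b) h2 !mul0r addr0.
have [s0|s0] := eqVneq s 0; last first.
  exists (s' / s); rewrite divfK //; split => //.
  apply: (mulfI s0); move/subr0_eq: det0 => ->.
  by rewrite mulrA mulrCA mulfV // mulr1 mulrC.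
have t0 : t != 0 by apply/eqP => t0; exact: nz.
exists (t' / t); rewrite divfK //; split => //.
move: det0; rewrite s0 mul0r sub0r => /eqP.
rewrite oppr_eq0 mulf_eq0 (negPf t0) orbF.
by move=> /eqP ->; rewrite mulr0.
Qed.

(** [F] is the last coordinate of a chart of M. For the codimension, T_q N is cut out by two
    coordinates of the chart of N, and dF induces a nonzero form on the plane quotient; its kernel,
    the image of T_q M, is a line. *)
Lemma adapted_exists M N p : submanifold n.+1 M -> submanifold n N ->
  N `<=` M -> N p -> exists W r F, adapted M N W r F /\ W p.
Proof.
move=> hM hN NM Np.
have [WM [WM' [PhM [PsM [[oM oM' WMp] [sPhM sPsM KM KM' SM]]]]]] := hM p (NM _ Np).
have [WN [WN' [Ph [Ps [[oN oN' WNp] [sPh sPs K K' SN]]]]]] := hN p Np.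
have [W1 [r [[oW1 W1N NW1 sr] [r1 r2]]]] := chart_retraction oN oN' sPh sPs K K' SN.
pose F x := PhM x ord0 ord_max.
have sF : smooth_on WM F by exact: smooth_on_coord.
pose i0 : 'I_n.+2 := inord n; pose i1 : 'I_n.+2 := ord_max.
have i0n : i0 = n :> nat by rewrite inordK.
have i01 : (i0 == i1) = false by rewrite -val_eqE /= i0n; apply/eqP/n_Sn.
have igeM (i : 'I_n.+2) : (n.+1 <= i)%N -> i = ord_max.
  by move=> ni; apply: val_inj => /=; apply/eqP; rewrite eqn_leq ni -ltnS ltn_ord.
have igeN (i : 'I_n.+2) : (n <= i)%N -> i = i0 \/ i = i1.
  rewrite leq_eqVlt => /orP[/eqP ni|/igeM]; last by right.
  by left; apply: val_inj => /=; rewrite i0n -ni.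
have TM q v : WM q -> M q -> tangent M q v <-> 'D_v F q = 0.
  move=> Wq Mq; have dPh := smooth_on_diff sPhM Wq.
  apply: (iff_trans (tangent_chart oM oM' sPhM sPsM KM KM' SM v Wq Mq)).
  rewrite -(derive_coord v ord_max dPh); split => [->//|h i /igeM ->//].
have TN q v : WN q -> N q -> tangent N q v <->
    ('D_v Ph q) ord0 i0 = 0 /\ ('D_v Ph q) ord0 i1 = 0.
  move=> Wq Nq; apply: (iff_trans (tangent_chart oN oN' sPh sPs K K' SN v Wq Nq)).
  split => [h|[h0 h1] i /igeN[]->//].
  by split; apply: h; rewrite ?i0n //= leqnSn.
(* Both x and r x must lie in the chart domain of M; since r (r x) = r x, this set is stable under
   r. *)
pose W := (W1 `&` [set x | WM (r x)]) `&` WM.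
have oW : open W.
  apply: openI; last exact: oM.
  exact: open_preimage_on oW1 oM (fun x => smooth_on_continuous sr).
have W1p : W1 p by apply: NW1.
exists W, r, F; split; last by split=> //; split=> //=; rewrite r2.
split=> //.
- by apply: smooth_on_sub sr => x [[]].
- by apply: smooth_on_sub sF => x [].
- move=> x [[W1x WMr] WMx]; have [Nr W1r] := r1 x W1x; split => //.
  by split=> //; split=> //=; rewrite r2.
- by move=> x [[W1x _] _]; exact: r2.
- by move=> q v [_ Wq] /NM; exact: TM.
move=> q xi v [[W1q _] WMq] Nq Txi nTxi Tv.
have WNq := W1N _ W1q; have Mq := NM _ Nq.
have dPh := smooth_on_diff sPh WNq; have dF := smooth_on_diff sF WMq.
(* (A, B) is dual to the pair of linear forms cutting out T_q N, so that dF,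
   which vanishes on T_q N, is a combination of these two forms. *)
pose A := 'D_(delta_mx ord0 i0) Ps (Ph q).
pose B := 'D_(delta_mx ord0 i1) Ps (Ph q).
have AE : 'D_A Ph q = delta_mx ord0 i0 by exact: (derive_PhiPsi oN' sPh sPs K K').
have BE : 'D_B Ph q = delta_mx ord0 i1 by exact: (derive_PhiPsi oN' sPh sPs K K').
clearbody A B.
pose al u := ('D_u Ph q) ord0 i0; pose be u := ('D_u Ph q) ord0 i1.
have FE u : 'D_u F q = 'D_A F q * al u + 'D_B F q * be u.
  have Tu : tangent N q (u - (al u *: A + be u *: B)).
    apply/TN => //.
    have -> : 'D_(u - (al u *: A + be u *: B)) Ph q =
        'D_u Ph q - (al u *: delta_mx ord0 i0 + be u *: delta_mx ord0 i1).
      rewrite (deriveBdir u (al u *: A + be u *: B) dPh).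
      rewrite (deriveDdir (al u *: A) (be u *: B) dPh).
      by rewrite (deriveZdir (al u) A dPh) (deriveZdir (be u) B dPh) AE BE.
    rewrite !mxE !eqxx i01 eq_sym i01 /= !mulr0 !mulr1 addr0 add0r.
    by rewrite !subrr.
  have /(TM _ _ WMq Mq) := tangent_sub NM Tu.
  rewrite (deriveBdir u (al u *: A + be u *: B) dF).
  rewrite (deriveDdir (al u *: A) (be u *: B) dF).
  rewrite (deriveZdir (al u) A dF) (deriveZdir (be u) B dF) => /subr0_eq ->.
  by congr (_ + _); exact: mulrC.
(* A vector with dF(C) = 1, which witnesses that F is a submersion at q. *)
pose C := 'D_(delta_mx ord0 ord_max) PsM (PhM q).
have CE : 'D_C F q = 1.
  rewrite -(derive_coord C ord_max (smooth_on_diff sPhM WMq)).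
  rewrite (_ : 'D_C PhM q = delta_mx ord0 ord_max) ?mxE ?eqxx //.
  exact: (derive_PhiPsi oM' sPhM sPsM KM KM').
have [||||c [c1 c2]] := @proportional_solutions ('D_A F q) ('D_B F q) (al C) (be C)
  (al xi) (be xi) (al v) (be v).
- by rewrite -FE CE.
- by rewrite -FE; apply/TM.
- by rewrite -FE; apply/TM.
- by move=> /(TN _ _ WNq Nq).
exists c; apply/TN => //.
rewrite (deriveBdir v (c *: xi) dPh) (deriveZdir c xi dPh) !mxE.
split; [exact: (etrans (congr1 (fun z => z - _) c1) (subrr _))|].
exact: (etrans (congr1 (fun z => z - _) c2) (subrr _)).
Qed.

Section AdaptedTheory.
Variables (M N W : set E) (r : E -> E) (F : E -> R).
Hypothesis ad : adapted M N W r F.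
Implicit Types (p q u v w : E).

Let oW : open W := adapted_open ad.
Let dr q : W q -> differentiable r q.
Proof. exact: smooth_on_diff (adapted_retr ad). Qed.
Let dF q : W q -> differentiable F q.
Proof. exact: smooth_on_diff (adapted_eqn ad). Qed.

(** As r fixes the points of N, dr fixes velocities of curves in N; conversely, if dr(v) = v, the
    image by r of the line in direction v is a curve in N with velocity v. *)
Lemma adapted_tangentN q v : W q -> N q -> tangent N q v <-> 'D_v r q = v.
Proof.
move=> Wq Nq; split.
  move=> [g gc].
  have := @is_derive_curve R n _ N W q v g id r gc oW Wq (adapted_retr ad)
    (adapted_fix ad).
  by have [e e0 [_ _ _ dg]] := gc => dg'; exact: is_derive_unique dg' dg.
have := @tangent_image R n N W q v r oW Wq (adapted_retr ad).
rewrite (adapted_fix ad) // => H rE; rewrite -rE.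
by apply: H => t Wt; exact: (adapted_im ad Wt).1.
Qed.

Lemma adapted_NM q v : tangent N q v -> tangent M q v.
Proof. exact/tangent_sub/(adapted_sub ad). Qed.

(** Valid also at points q off N; this makes a pull-back by r depend only on the values of a form on
    vectors tangent to N. *)
Lemma tangentN_derive q v : W q -> tangent N (r q) ('D_v r q).
Proof.
move=> Wq; apply: (tangent_image oW Wq (adapted_retr ad)) => t Wt.
exact: (adapted_im ad Wt).1.
Qed.

Lemma tangentN_derive_fix q v : W q -> N q -> tangent N q ('D_v r q).
Proof. by move=> Wq Nq; have := tangentN_derive v Wq; rewrite (adapted_fix ad). Qed.

Lemma tangentND q u v : W q -> N q -> tangent N q u -> tangent N q v ->
  tangent N q (u + v).
Proof.
move=> Wq Nq /(adapted_tangentN _ Wq Nq) hu /(adapted_tangentN _ Wq Nq) hv.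
by apply/(adapted_tangentN _ Wq Nq); rewrite (deriveDdir _ _ (dr Wq)) hu hv.
Qed.

Lemma tangentNZ q (a : R) u : W q -> N q -> tangent N q u -> tangent N q (a *: u).
Proof.
move=> Wq Nq /(adapted_tangentN _ Wq Nq) hu.
by apply/(adapted_tangentN _ Wq Nq); rewrite (deriveZdir _ _ (dr Wq)) hu.
Qed.

Lemma tangentNB q u v : W q -> N q -> tangent N q u -> tangent N q v ->
  tangent N q (u - v).
Proof.
move=> Wq Nq hu hv; rewrite -scaleN1r; apply: tangentND => //; exact: tangentNZ.
Qed.

Lemma tangentN0 q : W q -> N q -> tangent N q 0.
Proof. by move=> Wq Nq; apply/(adapted_tangentN _ Wq Nq); rewrite derive0. Qed.

Lemma tangentMD q u v : W q -> N q -> tangent M q u -> tangent M q v ->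
  tangent M q (u + v).
Proof.
move=> Wq Nq /(adapted_tangentM ad _ Wq Nq) hu /(adapted_tangentM ad _ Wq Nq) hv.
apply/(adapted_tangentM ad _ Wq Nq).
by rewrite (deriveDdir _ _ (dF Wq)) hu hv addr0.
Qed.

Lemma tangentMZ q (a : R) u : W q -> N q -> tangent M q u -> tangent M q (a *: u).
Proof.
move=> Wq Nq /(adapted_tangentM ad _ Wq Nq) hu.
by apply/(adapted_tangentM ad _ Wq Nq); rewrite (deriveZdir _ _ (dF Wq)) hu scaler0.
Qed.

End AdaptedTheory.
End Adapted.

(** * The osculating Darboux direction *)

Section DarbouxAlgebra.
Context {R : realType} {k : nat}.
Implicit Types (u v x y z : 'rV[R]_k) (A : 'M[R]_k).

Lemma dot_mulmxr u v A : dot u (v *m A) = dot (u *m A^T) v.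
Proof.
rewrite /dot; under eq_bigr do rewrite mxE big_distrr /=.
rewrite exchange_big /=; apply: eq_bigr => i _; rewrite mxE big_distrl /=.
by apply: eq_bigr => j _; rewrite mxE; ring.
Qed.

Variables (P H : 'M[R]_k).
Hypothesis PP : forall v, v *m P *m P = v *m P.
Hypothesis Hnondeg : forall z, z *m P = z ->
  (forall v, v *m P = v -> dot (v *m H) z = 0) -> z = 0.

(* The Gram matrix of the form H on the image of P, completed by the Euclidean
   scalar product on the image of 1 - P. *)
Definition darboux_gram := P *m (P *m H)^T + (1%:M - P) *m (1%:M - P)^T.

Lemma dot_darboux_gram z v : dot (z *m darboux_gram) v =
  dot (z *m P) (v *m P *m H) + dot (z - z *m P) (v - v *m P).
Proof.
rewrite /darboux_gram mulmxDr [LHS]dotDl !mulmxA -!dot_mulmxr !mulmxA.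
by rewrite !mulmxBr !mulmx1.
Qed.

Lemma darboux_gram_fixed z :
  (forall v, v *m P = 0 -> dot (z *m darboux_gram) v = 0) -> z *m P = z.
Proof.
move=> zG; pose y := z - z *m P.
have yP : y *m P = 0 by rewrite mulmxBl PP subrr.
have := zG y yP; rewrite dot_darboux_gram yP mul0mx dot0r add0r subr0.
by move=> /dot_eq0/subr0_eq.
Qed.

(** A vector of the kernel is fixed by P, because the Euclidean summand detects its part outside the
    image; on the image the form is H, which is non-degenerate there. *)
Lemma det_darboux_gram : \det darboux_gram != 0.
Proof.
apply/negP => /det0P[z z0 zG].
have zP : z *m P = z.
  by apply: darboux_gram_fixed => v _; rewrite zG dot0l.
case/eqP: z0; apply: Hnondeg => // v vP.
have := dot_darboux_gram z v; rewrite zG dot0l zP vP !subrr dot0r addr0.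
by rewrite dotC => <-.
Qed.

(** Cramer's rule: up to the factor - det, this is the H-orthogonal projection of x on the image of
    P. The adjugate replaces the inverse, so that the formula is polynomial and stays smooth off N,
    where the Gram matrix may be singular. *)
Definition darboux_correction x := - (x *m (P *m H)^T *m \adj darboux_gram).

Lemma dot_darboux_correction x v :
  dot (darboux_correction x *m darboux_gram) v =
  - (\det darboux_gram * dot x (v *m P *m H)).
Proof.
rewrite /darboux_correction mulNmx -[_ *m _ *m darboux_gram]mulmxA mul_adj_mx.
by rewrite mul_mx_scalar dotNl dotZl -dot_mulmxr mulmxA.
Qed.

Lemma darboux_correction_fixed x : darboux_correction x *m P = darboux_correction x.
Proof.
apply: darboux_gram_fixed => v vP.
by rewrite dot_darboux_correction vP mul0mx dot0r mulr0 oppr0.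
Qed.

Lemma darboux_correctionP x v : v *m P = v ->
  dot (v *m H) (\det darboux_gram *: x + darboux_correction x) = 0.
Proof.
move=> vP; have := dot_darboux_gram (darboux_correction x) v.
rewrite dot_darboux_correction vP subrr dot0r addr0 darboux_correction_fixed.
rewrite dotDr (dotC (v *m H)) dotZl (dotC _ (darboux_correction x)) => <-.
by rewrite subrr.
Qed.

End DarbouxAlgebra.

(** * Smooth matrix-valued functions *)

Section SmoothMatrices.
Context {R : realType} {U : normedModType R}.
Variables (W : set U) (oW : open W).

Definition smooth_mx k l (A : U -> 'M[R]_(k, l)) :=
  forall i j, smooth_on W (fun x => A x i j).

Lemma smooth_mxM k l m (A : U -> 'M[R]_(k, l)) (B : U -> 'M[R]_(l, m)) :
  smooth_mx A -> smooth_mx B -> smooth_mx (fun x => A x *m B x).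
Proof.
move=> sA sB i j; under eq_fun do rewrite mxE.
by apply: smooth_on_sum => // a; apply: smooth_onM.
Qed.

Lemma smooth_mxD k l (A B : U -> 'M[R]_(k, l)) :
  smooth_mx A -> smooth_mx B -> smooth_mx (fun x => A x + B x).
Proof.
by move=> sA sB i j; under eq_fun do rewrite mxE; exact: smooth_onD.
Qed.

Lemma smooth_mxN k l (A : U -> 'M[R]_(k, l)) :
  smooth_mx A -> smooth_mx (fun x => - A x).
Proof.
by move=> sA i j; under eq_fun do rewrite mxE; exact: smooth_onN.
Qed.

Lemma smooth_mx_tr k l (A : U -> 'M[R]_(k, l)) :
  smooth_mx A -> smooth_mx (fun x => (A x)^T).
Proof. by move=> sA i j; under eq_fun do rewrite mxE; exact: sA. Qed.

Lemma smooth_mx_cst k l (A : 'M[R]_(k, l)) : smooth_mx (fun=> A).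
Proof. by move=> i j; exact: smooth_on_cst. Qed.

Lemma smooth_on_det k (A : U -> 'M[R]_k) :
  smooth_mx A -> smooth_on W (fun x => \det (A x)).
Proof.
move=> sA; apply: smooth_on_sum => // s; apply: smooth_onM => //.
  exact: smooth_on_cst.
exact: smooth_on_prod.
Qed.

Lemma smooth_mx_adj k (A : U -> 'M[R]_k) :
  smooth_mx A -> smooth_mx (fun x => \adj (A x)).
Proof.
move=> sA i j; under eq_fun do rewrite mxE.
apply: smooth_onM => //; first exact: smooth_on_cst.
by apply: smooth_on_det => a b; under eq_fun do rewrite !mxE; exact: sA.
Qed.

Lemma smooth_mx_rV m (f : U -> 'rV[R]_m) : smooth_on W f -> smooth_mx f.
Proof. by move=> fs i j; rewrite (ord1 i); exact: smooth_on_coord. Qed.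

End SmoothMatrices.

Section Jacobian.
Context {R : realType} {m l : nat}.

Definition jac (f : 'rV[R]_m -> 'rV[R]_l) x : 'M[R]_(m, l) :=
  \matrix_(i, j) ('D_(delta_mx ord0 i) f x) ord0 j.

Lemma derive_jac f x v : differentiable f x -> 'D_v f x = v *m jac f x.
Proof.
move=> df; rewrite mulmx_sum_row (derive_basis v df).
by apply: eq_bigr => i _; congr (_ *: _); apply/rowP => j; rewrite !mxE.
Qed.

Lemma smooth_mx_jac W f : open W -> smooth_on W f -> smooth_mx W (jac f).
Proof.
move=> oW fs i j; under eq_fun do rewrite mxE.
by apply: smooth_on_coord => //; exact: smooth_on_derive.
Qed.

End Jacobian.

(** * The Darboux direction as an orthogonal for the Hessian *)

Section DarbouxDirection.
Context {R : realType} {n : nat}.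
Local Notation E := 'rV[R]_n.+2.
Variables (M N W : set E) (r : E -> E) (F : E -> R).
Hypothesis ad : adapted M N W r F.
Implicit Types (p q u v w x y : E) (O V : set E).

Let oW : open W := adapted_open ad.
Let Fs : smooth_on W F := adapted_eqn ad.

Definition hess q u v := 'D_u ('D_v F) q.

Lemma hess_sym q u v : W q -> hess q u v = hess q v u.
Proof. by move=> Wq; exact: Schwarz oW Fs Wq. Qed.

Lemma hess_jac q u v : W q -> hess q u v = dot (u *m jac (grad F) q) v.
Proof.
move=> Wq; rewrite /hess -(derive_grad u v oW Fs Wq) dotC.
by rewrite (derive_jac u (smooth_on_diff (smooth_on_grad oW Fs) Wq)).
Qed.

Lemma smooth_along_extension (A : normedModType R) O (f : E -> A) q : open O ->
  smooth_along (N `&` O) f -> W q -> N q -> O q -> exists V g,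
  [/\ open V, V q, V `<=` W `&` O, smooth_on V g &
    forall x, V x -> N x -> g x = f x].
Proof.
move=> oO fs Wq Nq Oq; have [V [g [oV Vq gs gf]]] := fs q (conj Nq Oq).
exists (V `&` (W `&` O)), g; split.
- by apply: openI => //; exact: openI.
- by [].
- exact: subIsetr.
- exact: smooth_on_sub (@subIsetl _ _ _) gs.
- by move=> x [Vx [_ Ox]] Nx; apply: gf.
Qed.

(** Both derivatives are computed along one curve in N with velocity v, on which f and g agree. *)
Lemma derive_tangent_eq (A : normedModType R) V (f g : E -> A) q v : open V ->
  V q -> smooth_on V f -> smooth_on V g ->
  (forall x, V x -> N x -> f x = g x) -> tangent N q v -> 'D_v f q = 'D_v g q.
Proof.
move=> oV Vq fs gs fg [c cc].
have h1 := @is_derive_curve R n A N V q v c f f cc oV Vq fs (fun _ _ _ => erefl).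
have h2 := @is_derive_curve R n A N V q v c f g cc oV Vq gs
  (fun x Vx Nx => esym (fg x Vx Nx)).
exact: is_derive_unique h1 h2.
Qed.

Lemma flatD_extension V O q v (f g : E -> E) : open V -> open O -> V q -> O q ->
  smooth_on V g -> (forall x, V x -> N x -> g x = f x) -> tangent N q v ->
  flatD (N `&` O) f q v = 'D_v g q.
Proof.
move=> oV oO Vq Oq gs gf Tv.
have Tv' : tangent (N `&` O) q v by apply/tangent_setI.
by apply: (flatDE Tv' oV Vq gs) => x Vx [Nx _]; exact: gf.
Qed.

(** Tangency of Y to M means dF(Y) = 0 along N. Differentiating this in a direction v of T_q N gives
    dF(D_v Y) + hess(v, Y) = 0; hence D_v Y is tangent to M exactly when Y is orthogonal to v for
    the Hessian. *)
Lemma derive_eqn_flatD O (Y : E -> E) q v : open O -> O q -> N q -> W q ->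
  smooth_along (N `&` O) Y ->
  (forall x, (N `&` O) x -> tangent M x (Y x)) -> tangent N q v ->
  'D_(flatD (N `&` O) Y q v) F q = - hess q v (Y q).
Proof.
move=> oO Oq Nq Wq Ys YM Tv.
have [V [g [oV Vq VWO gs gY]]] := smooth_along_extension oO Ys Wq Nq Oq.
rewrite (flatD_extension oV oO Vq Oq gs gY Tv) -(gY q Vq Nq).
have FVs : smooth_on V F by apply: smooth_on_sub Fs => x /VWO[].
have := derive_contract v oV FVs gs Vq.
have s0 : smooth_on V (fun _ : E => 0 : R) by exact: smooth_on_cst.
rewrite (derive_tangent_eq oV Vq (smooth_on_contract oV FVs gs) s0 _ Tv).
  by rewrite derive_cst => /esym/eqP; rewrite addr_eq0 => /eqP.
move=> x Vx Nx; have [Wx Ox] := VWO x Vx.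
by apply/(adapted_tangentM ad _ Wx Nx); rewrite gY //; exact: YM.
Qed.

Definition nondegenerate_at q := forall x, tangent N q x ->
  (forall y, tangent N q y -> hess q x y = 0) -> x = 0.

(* h2 (x, y) is - hess (x, y) / dF (eta). *)
Lemma nondegenerate_hess O xi1 eta q : open O -> O q -> N q -> W q ->
  tangent_transversal M (N `&` O) xi1 -> transversal_along M (N `&` O) eta ->
  (forall x, tangent N q x ->
    (forall y, tangent N q y -> h2 (N `&` O) xi1 eta q x y = 0) -> x = 0) ->
  nondegenerate_at q.
Proof.
move=> oO Oq Nq Wq [_ Txi] [_ Teta] nd x Tx Hx; apply: nd => // y Ty.
(* If no decomposition exists, [h2] has its default value 0, as wanted. *)
rewrite /h2; case: xgetP => // c _.
move=> [V [Y [[oV Vq [Ys YT] Yq]]]].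
have [Txi1 _] := Txi q (conj Nq Oq).
have nTeta := Teta q (conj Nq Oq).
move=> [nb [h1 [Tnb]]].
rewrite -setIA => fE.
have oOO : open (O `&` V) by exact: openI.
rewrite -setIA in Ys YT.
have YM z : (N `&` (O `&` V)) z -> tangent M z (Y z).
  by move=> Sz; apply: (adapted_NM ad); apply/(tangent_setI _ _ oOO Sz.2)/YT.
have := derive_eqn_flatD oOO (conj Oq Vq) Nq Wq Ys YM Tx.
rewrite Yq (Hx y Ty) oppr0 fE.
have dF := smooth_on_diff Fs Wq.
rewrite (deriveDdir (nb + h1 *: xi1 q) (c *: eta q) dF).
rewrite (deriveDdir nb (h1 *: xi1 q) dF) (deriveZdir h1 (xi1 q) dF).
rewrite (deriveZdir c (eta q) dF).
have -> : 'D_nb F q = 0.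
  apply/(adapted_tangentM ad _ Wq Nq)/(adapted_NM ad).
  exact/(tangent_setI _ _ oO Oq).
have -> : 'D_(xi1 q) F q = 0 by apply/(adapted_tangentM ad _ Wq Nq).
rewrite scaler0 !add0r => /eqP; rewrite scaler_eq0 => /orP[/eqP //|/eqP e0].
by exfalso; apply: nTeta; apply/(adapted_tangentM ad _ Wq Nq).
Qed.

Lemma darboux_transversal O xi q : open O -> O q -> N q ->
  darboux_field M (N `&` O) xi -> tangent M q (xi q) /\ ~ tangent N q (xi q).
Proof.
move=> oO Oq Nq [[_ /(_ q (conj Nq Oq))[TM nTN]] _]; split => // TN.
by apply: nTN; apply/tangent_setI.
Qed.

Lemma darboux_hess O xi q v : open O -> O q -> N q -> W q ->
  darboux_field M (N `&` O) xi -> tangent N q v -> hess q v (xi q) = 0.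
Proof.
move=> oO Oq Nq Wq [[xis xiT] xiD] Tv.
have Tv' : tangent (N `&` O) q v by apply/tangent_setI.
have := xiD q (conj Nq Oq) v Tv'.
move=> /(adapted_tangentM ad _ Wq Nq); rewrite derive_eqn_flatD //.
  by move=> /eqP; rewrite oppr_eq0 => /eqP.
by move=> x Sx; have [] := xiT x Sx.
Qed.

(** By codimension 1, some xi0 - c xi is tangent to N; it is also Hessian-orthogonal to T_q N, so it
    vanishes by non-degeneracy. *)
Lemma darboux_line O O' xi xi0 q : open O -> O q -> open O' -> O' q -> N q ->
  W q -> darboux_field M (N `&` O) xi -> darboux_field M (N `&` O') xi0 ->
  nondegenerate_at q -> exists c : R, c != 0 /\ xi0 q = c *: xi q.
Proof.
move=> oO Oq oO' O'q Nq Wq dxi dxi0 nd.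
have [TM nTN] := darboux_transversal oO Oq Nq dxi.
have [TM0 nTN0] := darboux_transversal oO' O'q Nq dxi0.
have [c Tc] := adapted_decomp ad Wq Nq TM nTN TM0.
have z0 : xi0 q - c *: xi q = 0.
  apply: nd => // y Ty; rewrite hess_sym // hess_jac // dotBr.
  rewrite (dotC _ (c *: xi q)) dotZl (dotC (xi q)) -!hess_jac //.
  rewrite (darboux_hess oO Oq Nq Wq dxi Ty).
  by rewrite (darboux_hess oO' O'q Nq Wq dxi0 Ty) mulr0 subrr.
have xiE := subr0_eq z0; exists c; split => //.
apply/eqP => c0; apply: nTN0; rewrite xiE c0 scale0r.
exact: (tangentN0 ad).
Qed.

(** Any transversal field is made orthogonal to T_q N by a correction tangent to N. Along N the
    determinant in front of [x1] is nonzero, which preserves transversality; off N it is free to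
    vanish. *)
Lemma darboux_exists O xi1 p : open O -> O p -> N p -> W p ->
  tangent_transversal M (N `&` O) xi1 ->
  (forall q, N q -> O q -> W q -> nondegenerate_at q) ->
  exists V xi0, [/\ open V, V p, V `<=` W, smooth_on V xi0 &
    darboux_field M (N `&` V) xi0].
Proof.
move=> oO Op Np Wp [xis xiT] nd.
have [V [x1 [oV Vp VWO x1s x1E]]] := smooth_along_extension oO xis Wp Np Op.
have VW q : V q -> W q by move=> /VWO[].
have rs : smooth_on V r by exact: smooth_on_sub VW (adapted_retr ad).
have FVs : smooth_on V F by exact: smooth_on_sub VW Fs.
pose P := jac r; pose H := jac (grad F).
have Ps : smooth_mx V P by exact: smooth_mx_jac.
have Hs : smooth_mx V H by apply: smooth_mx_jac => //; exact: smooth_on_grad.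
have QTs : smooth_mx V (fun q => (P q *m H q)^T).
  by apply: smooth_mx_tr; exact: smooth_mxM.
have P1s : smooth_mx V (fun q => 1%:M - P q).
  by apply: smooth_mxD => //; [exact: smooth_mx_cst|exact: smooth_mxN].
have Gs : smooth_mx V (fun q => darboux_gram (P q) (H q)).
  apply: smooth_mxD => //; apply: smooth_mxM => //.
  exact: smooth_mx_tr.
have Zs : smooth_mx V (fun q => darboux_correction (P q) (H q) (x1 q)).
  apply: smooth_mxN => //; apply: smooth_mxM => //; last exact: smooth_mx_adj.
  by apply: smooth_mxM => //; exact: smooth_mx_rV.
pose x0 q := \det (darboux_gram (P q) (H q)) *: x1 q +
  darboux_correction (P q) (H q) (x1 q).
have x0s : smooth_on V x0.
  apply: smooth_onD => //; last by apply: smooth_on_rV => // i; exact: Zs.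
  by apply: smooth_onZ => //; exact: smooth_on_det.
have PE q v : V q -> 'D_v r q = v *m P q.
  by move=> Vq; apply: derive_jac; exact: smooth_on_diff rs Vq.
have TP q v : V q -> N q -> tangent N q v <-> v *m P q = v.
  by move=> Vq Nq; rewrite -PE //; apply: (adapted_tangentN ad) => //; exact: VW.
have PP q : V q -> N q -> forall v, v *m P q *m P q = v *m P q.
  move=> Vq Nq v; apply/TP => //; rewrite -PE //.
  by apply: (tangentN_derive_fix ad) => //; exact: VW.
have Pnd q : V q -> N q -> forall z, z *m P q = z ->
    (forall v, v *m P q = v -> dot (v *m H q) z = 0) -> z = 0.
  move=> Vq Nq z /(TP q _ Vq Nq) Tz Hz; have [Wq Oq] := VWO q Vq.
  apply: (nd q Nq Oq Wq) => // y /(TP q _ Vq Nq) Py.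
  by rewrite hess_sym // hess_jac //; exact: Hz.
have x0M q : V q -> N q -> tangent M q (x0 q) /\ ~ tangent N q (x0 q).
  move=> Vq Nq; have [Wq Oq] := VWO q Vq.
  have [TM1 nTN1] := xiT q (conj Nq Oq).
  have TZ : tangent N q (darboux_correction (P q) (H q) (x1 q)).
    by apply/TP => //; apply: darboux_correction_fixed; exact: PP.
  rewrite /x0 (x1E q Vq Nq) in TZ *; split.
    apply: (tangentMD ad) => //; last exact: (adapted_NM ad).
    exact: (tangentMZ ad).
  move=> T0; apply: nTN1; apply/tangent_setI => //.
  have d0 := det_darboux_gram (PP q Vq Nq) (Pnd q Vq Nq).
  rewrite -[xi1 q]scale1r -(mulVf d0) -scalerA.
  apply: (tangentNZ ad) => //.
  rewrite -[X in tangent N q X](addrK (darboux_correction (P q) (H q) (xi1 q))).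
  exact: (tangentNB ad).
exists V, x0; split => //; split; first split.
- by move=> q [Nq Vq]; exists V, x0; split.
- move=> q [Nq Vq]; have [TM nTN] := x0M q Vq Nq; split => // TN.
  by apply: nTN; apply/tangent_setI; [exact: oV|exact: Vq|exact: TN].
move=> q [Nq Vq] v /(tangent_setI _ _ oV Vq) Tv; have Wq := VW q Vq.
apply/(adapted_tangentM ad _ Wq Nq).
rewrite (derive_eqn_flatD oV Vq Nq Wq _ _ Tv).
- rewrite hess_jac // darboux_correctionP ?oppr0 //; first exact: PP.
  by apply/TP.
- by move=> z [Nz Vz]; exists V, x0; split.
- by move=> z [Nz Vz]; have [] := x0M z Vz Nz.
Qed.

End DarbouxDirection.

(** * Normal curvature and parallel fields *)

Section Curvature.
Context {R : realType} {n : nat}.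
Local Notation E := 'rV[R]_n.+2.
Variables (M N W : set E) (r : E -> E) (F : E -> R).
Hypothesis ad : adapted M N W r F.
Implicit Types (p q u v w x y : E) (O V : set E) (X Y eta t : E -> E).

(** Differentiate dr(Z) = Z along N for Z = X and Z = Y: the second derivatives of r cancel by
    symmetry, so the bracket is fixed by dr. *)
Lemma lie_bracket_tangent V X Y p : open V -> V p -> V `<=` W -> N p ->
  smooth_on V X -> smooth_on V Y ->
  (forall x, V x -> N x -> tangent N x (X x)) ->
  (forall x, V x -> N x -> tangent N x (Y x)) ->
  tangent N p ('D_(X p) Y p - 'D_(Y p) X p).
Proof.
move=> oV Vp VW Np Xs Ys TX TY; have Wp := VW p Vp.
have rs : smooth_on V r by exact: smooth_on_sub VW (adapted_retr ad).
have der Z u : smooth_on V Z -> (forall x, V x -> N x -> tangent N x (Z x)) ->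
    tangent N p u -> 'D_u Z p = 'D_('D_u Z p) r p + 'D_u ('D_(Z p) r) p.
  move=> Zs TZ Tu; rewrite -(derive_contract_rV u oV rs Zs Vp).
  apply: (derive_tangent_eq oV Vp Zs _ _ Tu); first exact: smooth_on_contract_rV.
  move=> x Vx Nx; apply/esym.
  exact/(adapted_tangentN ad _ (VW x Vx) Nx)/TZ.
have dX := der X (Y p) Xs TX (TY p Vp Np).
have dY := der Y (X p) Ys TY (TX p Vp Np).
apply/(adapted_tangentN ad _ Wp Np).
rewrite (deriveBdir ('D_(X p) Y p) ('D_(Y p) X p) (smooth_on_diff rs Vp)).
have cancel (A B a b s1 s2 : E) : b = B + s2 -> a = A + s1 -> s1 = s2 ->
    A - B = a - b.
  by move=> -> -> ->; rewrite opprD addrACA subrr addr0.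
exact: cancel dX dY (Schwarz_rV (Y p) (X p) oV rs Vp).
Qed.

Section Connection.
Variables (O V : set E) (xi0 x0 t : E -> E).
Hypotheses (oO : open O) (oV : open V) (VWO : V `<=` W `&` O).
Hypotheses (x0s : smooth_on V x0) (ts : smooth_on V t).
Hypothesis xi0E : forall q, V q -> N q -> exists c : R, c != 0 /\ xi0 q = c *: x0 q.
Hypothesis x0T : forall q, V q -> N q -> ~ tangent N q (x0 q).
Hypothesis x0t : forall q v, V q -> N q -> tangent N q v ->
  tangent N q ('D_v x0 q - dot v (t q) *: x0 q).

(** The rule nabla_X (f x0) = (X f + f tau(X)) x0. The field [eta] is only required to equal f x0 on
    N, and [xi0] serves only to span the line of [x0]. *)
Lemma normal_connectionE (f : E -> R) eta X q : smooth_on V f ->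
  (forall x, V x -> N x -> f x *: x0 x = eta x) -> V q -> N q ->
  tangent N q (X q) ->
  normal_connection (N `&` O) xi0 X eta q =
  ('D_(X q) f q + f q * dot (X q) (t q)) *: x0 q.
Proof.
move=> fs fE Vq Nq TX; have [Wq Oq] := VWO Vq.
have [c [c0 cE]] := xi0E Vq Nq.
have fx0s : smooth_on V (fun x => f x *: x0 x) by exact: smooth_onZ.
have flE : flatD (N `&` O) eta q (X q) =
    'D_(X q) f q *: x0 q + f q *: 'D_(X q) x0 q.
  rewrite (flatD_extension oV oO Vq Oq fx0s fE TX).
  exact: derive_scale (smooth_on_diff fs Vq) (smooth_on_diff x0s Vq).
set a := _ + _; pose z := 'D_(X q) x0 q - dot (X q) (t q) *: x0 q.
have Tz : tangent N q (f q *: z) by apply: (tangentNZ ad) => //; exact: x0t.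
have flz : flatD (N `&` O) eta q (X q) = f q *: z + a *: x0 q.
  rewrite flE /z /a scalerBr scalerDl scalerA [RHS]addrC [X in _ = _ + X]addrC.
  by rewrite addrA addrK.
apply: xget_unique.
  (* The component is a x0 and xi0 = c x0, whence the coefficient a / c relative to xi0. *)
  exists (- (f q *: z)), (a / c); split.
  - apply/tangent_setI => //; rewrite -scaleN1r; exact: (tangentNZ ad).
  - by rewrite cE scalerA divfK.
  - by rewrite opprK.
move=> w [SX [b [/(tangent_setI _ _ oO Oq) TS wE]]].
rewrite flz => H; apply/eqP; rewrite -subr_eq0; apply: contraT => nz.
exfalso; apply: (x0T Vq Nq).
have wx : w = (b * c) *: x0 q by rewrite wE cE scalerA.
(* The difference of two candidate components is a multiple of x0 tangent to N; were it nonzero, x0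
   would be tangent to N. *)
have H2 : (b * c - a) *: x0 q = f q *: z + SX.
  rewrite scalerBl -wx; apply/eqP; rewrite subr_eq addrAC H.
  by rewrite addrAC addNr add0r.
have d0 : b * c - a != 0.
  by apply: contra nz => /eqP d0; rewrite wx -scalerBl d0 scale0r.
rewrite -[x0 q]scale1r -(mulVf d0) -scalerA H2.
by apply: (tangentNZ ad) => //; exact: (tangentND ad).
Qed.

End Connection.

(** The bracketed difference is dt(Y, X) for the 1-form represented by t. The coefficient rule is
    applied twice, to smooth extensions of X and Y. *)
Lemma normal_curvatureE O V (xi0 x0 : E -> E) t (f : E -> R) eta X Y p :
  open O -> open V -> V `<=` W `&` O -> smooth_on V x0 -> smooth_on V t ->
  (forall q, V q -> N q -> exists c : R, c != 0 /\ xi0 q = c *: x0 q) ->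
  (forall q, V q -> N q -> ~ tangent N q (x0 q)) ->
  (forall q v, V q -> N q -> tangent N q v ->
    tangent N q ('D_v x0 q - dot v (t q) *: x0 q)) ->
  smooth_on V f -> (forall x, V x -> N x -> f x *: x0 x = eta x) ->
  tangent_field (N `&` O) X -> tangent_field (N `&` O) Y -> V p -> N p ->
  normal_curvature (N `&` O) xi0 X Y eta p =
  (f p * (dot (X p) ('D_(Y p) t p) - dot (Y p) ('D_(X p) t p))) *: x0 p.
Proof.
move=> oO oV0 VWO0 x0s0 ts0 xi0E0 x0T0 x0t0 fs0 fE0 [Xs XT] [Ys YT] V0p Np.
have [Wp Op] := VWO0 p V0p.
have [VX [X' [oX VXp VXW X's X'E]]] := smooth_along_extension ad oO Xs Wp Np Op.
have [VY [Y' [oY VYp VYW Y's Y'E]]] := smooth_along_extension ad oO Ys Wp Np Op.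
pose V1 := V `&` (VX `&` VY).
have oV : open V1 by apply: openI => //; exact: openI.
have Vp : V1 p by [].
have V1V : V1 `<=` V by move=> x [].
have VW x : V1 x -> W x by move=> [/VWO0[]].
have VWO : V1 `<=` W `&` O by move=> x [/VWO0].
have x0s := smooth_on_sub V1V x0s0; have ts := smooth_on_sub V1V ts0.
have fs := smooth_on_sub V1V fs0.
have {}X's : smooth_on V1 X' by apply: smooth_on_sub X's => x [_ []].
have {}Y's : smooth_on V1 Y' by apply: smooth_on_sub Y's => x [_ []].
have {}X'E x : V1 x -> N x -> X' x = X x by move=> [_ []] *; exact: X'E.
have {}Y'E x : V1 x -> N x -> Y' x = Y x by move=> [_ []] *; exact: Y'E.
have TX x : V1 x -> N x -> tangent N x (X x).
  move=> V1x Nx; have [Wx Ox] := VWO x V1x.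
  by apply/(tangent_setI _ _ oO Ox)/XT.
have TY x : V1 x -> N x -> tangent N x (Y x).
  move=> V1x Nx; have [Wx Ox] := VWO x V1x.
  by apply/(tangent_setI _ _ oO Ox)/YT.
have ncE (g : E -> R) (zeta Z : E -> E) q : smooth_on V1 g ->
    (forall x, V1 x -> N x -> g x *: x0 x = zeta x) ->
    V1 q -> N q -> tangent N q (Z q) ->
    normal_connection (N `&` O) xi0 Z zeta q =
    ('D_(Z q) g q + g q * dot (Z q) (t q)) *: x0 q.
  apply: (normal_connectionE oO oV VWO x0s) => [x|x|x v] V1x.
  - by apply: xi0E0; exact: V1V.
  - by apply: x0T0; exact: V1V.
  - by apply: x0t0; exact: V1V.
(* The coefficient of nabla_Z (f x0) along x0; it is smooth on [V1], so the rule [ncE] applies to it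
   again. *)
pose a (Z : E -> E) x := 'D_(Z x) f x + f x * dot (Z x) (t x).
have as_ Z : smooth_on V1 Z -> smooth_on V1 (a Z).
  move=> Zs; apply: smooth_onD => //; first exact: smooth_on_contract.
  by apply: smooth_onM => //; exact: smooth_on_dot.
have ncZ (Z Z' : E -> E) x : (forall x, V1 x -> N x -> Z' x = Z x) ->
    (forall x, V1 x -> N x -> tangent N x (Z x)) -> V1 x -> N x ->
    a Z' x *: x0 x = normal_connection (N `&` O) xi0 Z eta x.
  move=> ZE TZ V1x Nx; rewrite (ncE f eta Z x fs _ V1x Nx (TZ x V1x Nx)).
    by rewrite /a ZE.
  by move=> y /V1V; exact: fE0.
have Dp (A : normedModType R) (g : E -> A) : smooth_on V1 g -> differentiable g p.
  by move=> gs; exact: smooth_on_diff gs Vp.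
have aE Z u : smooth_on V1 Z -> 'D_u (a Z) p =
    'D_('D_u Z p) f p + 'D_u ('D_(Z p) f) p + ('D_u f p * dot (Z p) (t p) +
    f p * (dot ('D_u Z p) (t p) + dot (Z p) ('D_u t p))).
  move=> Zs; have s1 := smooth_on_contract oV fs Zs.
  have s2 := smooth_on_dot oV Zs ts.
  have s3 := smooth_onM oV fs s2.
  have -> : 'D_u (a Z) p = 'D_u (fun x => 'D_(Z x) f x) p +
      'D_u (fun x => f x * dot (Z x) (t x)) p.
    exact: deriveD (diff_derivable (Dp _ _ s1)) (diff_derivable (Dp _ _ s3)).
  congr (_ + _); first exact: derive_contract oV fs Zs Vp.
  apply: (etrans (derive_mul u (Dp _ _ fs) (Dp _ _ s2))).
  by congr (_ + _ * _); exact: derive_dot (Dp _ _ Zs) (Dp _ _ ts).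
have BE : lie_bracket (N `&` O) X Y p = 'D_(X p) Y' p - 'D_(Y p) X' p.
  rewrite /lie_bracket; congr (_ - _).
    exact: flatD_extension oV oO Vp Op Y's Y'E (TX p Vp Np).
  exact: flatD_extension oV oO Vp Op X's X'E (TY p Vp Np).
have BT : tangent N p (lie_bracket (N `&` O) X Y p).
  rewrite BE -(X'E p Vp Np) -(Y'E p Vp Np).
  apply: (lie_bracket_tangent oV Vp VW Np X's Y's) => x V1x Nx.
    by rewrite X'E //; exact: TX.
  by rewrite Y'E //; exact: TY.
have n1 := ncE (a X') _ Y p (as_ X' X's)
  (fun x Vx Nx => ncZ X X' x X'E TX Vx Nx) Vp Np (TY p Vp Np).
have n2 := ncE (a Y') _ X p (as_ Y' Y's)
  (fun x Vx Nx => ncZ Y Y' x Y'E TY Vx Nx) Vp Np (TX p Vp Np).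
have n3 := ncE f eta (lie_bracket (N `&` O) X Y) p fs
  (fun x Vx Nx => fE0 x (V1V x Vx) Nx) Vp Np BT.
rewrite /normal_curvature n1 n2 n3 -scalerBl -scalerDl; congr (_ *: _).
rewrite (aE X' (Y p) X's) (aE Y' (X p) Y's) BE dotBl /a.
rewrite (deriveBdir ('D_(X p) Y' p) ('D_(Y p) X' p) (Dp _ _ fs)).
rewrite (X'E p Vp Np) (Y'E p Vp Np).
(* The terms differentiating X or Y are absorbed by the bracket term and the products of first-order
   terms cancel in pairs; s1 and s2 are the two mixed second derivatives of f. *)
have cancel (s1 s2 s3 s4 s5 s6 s7 s8 s9 s10 s11 s12 s13 : R) : s1 = s2 ->
    s3 + s1 + (s12 * s9 + s13 * (s5 + s7)) + (s11 + s13 * s9) * s10 -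
    (s4 + s2 + (s11 * s10 + s13 * (s6 + s8)) + (s12 + s13 * s10) * s9) +
    (s4 - s3 + s13 * (s6 - s5)) = s13 * (s7 - s8).
  by move=> ->; ring.
exact: cancel (Schwarz (X p) (Y p) oV fs Vp).
Qed.

End Curvature.

(** * Flatness against existence of parallel fields *)

Section FlatParallel.
Context {R : realType} {n : nat}.
Local Notation E := 'rV[R]_n.+2.
Implicit Types (p q u v w x y : E).

Lemma open_neq0 (V : set E) (f : E -> R) : open V -> smooth_on V f ->
  open (V `&` [set x | f x != 0]).
Proof.
move=> oV fs; have oN : open [set y : R | y != 0] by exact: open_neq.
exact: (open_preimage_on oV oN (fun x Vx => smooth_on_continuous fs Vx)).
Qed.

Section WithAdapted.
Variables (M N W : set E) (r : E -> E) (F : E -> R).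
Hypothesis ad : adapted M N W r F.

Lemma nontangent_dot_neq0 q v : W q -> N q -> ~ tangent N q v -> dot v v != 0.
Proof.
move=> Wq Nq nT; apply/eqP => /dot_eq0 v0; apply: nT; rewrite v0.
exact: (tangentN0 ad).
Qed.

(* The 1-form v |-> dot v (t q) is tau_1^1, the coefficient of D_v x0 along x0. *)
Lemma normal_connection_form V (x0 : E -> E) p : open V -> V `<=` W ->
  smooth_on V x0 -> darboux_field M (N `&` V) x0 -> V p -> N p ->
  exists V1 t, [/\ open V1, V1 `<=` V, V1 p, smooth_on V1 t &
    forall q v, V1 q -> N q -> tangent N q v ->
      tangent N q ('D_v x0 q - dot v (t q) *: x0 q)].
Proof.
move=> oV VW x0s dx0 Vp Np.
have rs : smooth_on V r by exact: smooth_on_sub VW (adapted_retr ad).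
have rD q u : V q -> 'D_u r q = u *m jac r q.
  by move=> Vq; exact: derive_jac (smooth_on_diff rs Vq).
(* On N, 1 - dr kills T_q N but not x0, so [nu] is nonzero there and detects the component along
   x0. *)
pose nu x := x0 x - 'D_(x0 x) r x.
have nus : smooth_on V nu.
  by apply: smooth_onB => //; exact: smooth_on_contract_rV.
pose rho x := dot (nu x) (nu x).
have rhos : smooth_on V rho by exact: smooth_on_dot.
pose V1 := V `&` [set x | rho x != 0].
have oV1 : open V1 by exact: open_neq0.
have V1V : V1 `<=` V by move=> x [].
pose Q x := jac x0 x *m (1%:M - jac r x).
(* If D_v x0 = z + c x0 with z tangent to N, then applying 1 - dr gives v Q = c nu, and c = dot (v
   Q) nu / rho; [t] represents this linear form in v. *)
pose t x := (rho x)^-1 *: (nu x *m (Q x)^T).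
have rho0 q : V q -> N q -> rho q != 0.
  move=> Vq Nq; apply/eqP => /dot_eq0/subr0_eq xE.
  have [_ []] := darboux_transversal oV Vq Nq dx0.
  by rewrite xE; exact: (tangentN_derive_fix ad _ (VW _ Vq) Nq).
have nus1 := smooth_on_sub V1V nus; have rs1 := smooth_on_sub V1V rs.
have x0s1 := smooth_on_sub V1V x0s; have rhos1 := smooth_on_sub V1V rhos.
have ts : smooth_on V1 t.
  apply: smooth_onZ => //; first by apply: smooth_onV => // x [].
  apply: smooth_on_rV => // i; apply: (smooth_mxM oV1).
    exact: smooth_mx_rV.
  apply: smooth_mx_tr; apply: (smooth_mxM oV1); first exact: smooth_mx_jac.
  apply: (smooth_mxD oV1); first exact: smooth_mx_cst.
  by apply: (smooth_mxN oV1); exact: smooth_mx_jac.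
have V1p : V1 p by split; [exact: Vp|exact: rho0].
exists V1, t; split; [exact: oV1|exact: V1V|exact: V1p|exact: ts|].
move=> q v [Vq _] Nq Tv; have Wq := VW q Vq.
have [TM nTN] := darboux_transversal oV Vq Nq dx0.
have TD : tangent M q ('D_v x0 q).
  rewrite -(flatD_extension oV oV Vq Vq x0s (fun _ _ _ => erefl) Tv).
  apply: dx0.2; first by [].
  by apply/tangent_setI.
have [c Tc] := adapted_decomp ad Wq Nq TM nTN TD.
suff -> : dot v (t q) = c by [].
have /(adapted_tangentN ad _ Wq Nq) := Tc; rewrite (rD q _ Vq).
set z := _ - _ => zP.
have DE : 'D_v x0 q = z + c *: x0 q by rewrite subrK.
have zQ : v *m Q q = c *: nu q.
  rewrite mulmxA -(derive_jac v (smooth_on_diff x0s Vq)) DE mulmxBr mulmx1.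
  by rewrite mulmxDl zP -scalemxAl -(rD q _ Vq) opprD addrACA subrr add0r scalerBr.
rewrite dotC dotZl -dot_mulmxr zQ dotC dotZl -/(rho q).
by rewrite mulrC mulfK // rho0.
Qed.

Section Integration.
Variables (V : set E) (x0 t : E -> E) (p : E).
Hypotheses (oV : open V) (VW : V `<=` W) (Vp : V p) (Np : N p).
Hypotheses (x0s : smooth_on V x0) (ts : smooth_on V t).
Hypothesis dx0 : darboux_field M (N `&` V) x0.
Hypothesis x0t : forall q v, V q -> N q -> tangent N q v ->
  tangent N q ('D_v x0 q - dot v (t q) *: x0 q).

Let rs : smooth_on V r. Proof. exact: smooth_on_sub VW (adapted_retr ad). Qed.

(** Flatness is applied to the fields dr(u) and dr(v), which are tangent to N and take the values u
    and v at q, with the constant function 1; the curvature is then dt(v, u) x0, and x0 is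
    nonzero. *)
Lemma flat_form_closed q u v : flat_normal_bundle M N -> V q -> N q ->
  tangent N q u -> tangent N q v -> dot u ('D_v t q) = dot v ('D_u t q).
Proof.
move=> flat Vq Nq Tu Tv; have Wq := VW Vq.
have Tf a : tangent_field (N `&` V) ('D_a r).
  split=> [x [Nx Vx]|x [Nx Vx]].
    by exists V, ('D_a r); split => //; exact: smooth_on_derive.
  apply/(tangent_setI _ _ oV Vx).
  exact: (tangentN_derive_fix ad _ (VW Vx) Nx).
have ones : smooth_on V (fun _ : E => 1 : R) by exact: smooth_on_cst.
have onesa : smooth_along (N `&` V) (fun _ : E => 1 : R).
  by move=> x [Nx Vx]; exists V, (fun=> 1); split.
have := flat V x0 oV dx0 (fun=> 1) ('D_u r) ('D_v r) onesa (Tf u) (Tf v) q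
  (conj Nq Vq).
have VWV : V `<=` W `&` V by move=> x Vx; split=> //; exact: VW.
rewrite (normal_curvatureE ad oV oV VWV x0s ts _ _ x0t ones _ (Tf u) (Tf v) Vq Nq).
- rewrite mul1r ((adapted_tangentN ad _ Wq Nq).1 Tu).
  rewrite ((adapted_tangentN ad _ Wq Nq).1 Tv) => /eqP.
  rewrite scaler_eq0 => /orP[/eqP/subr0_eq //|/eqP x00].
  have [_] := darboux_transversal oV Vq Nq dx0.
  by case; rewrite x00; exact: (tangentN0 ad Wq Nq).
- by move=> x Vx Nx; exists 1; rewrite oner_eq0 scale1r.
- by move=> x Vx Nx; exact: (darboux_transversal oV Vx Nx dx0).2.
- by [].
Qed.

(* The pull-back of the form t along the retraction r is a closed form on an
   open set of the ambient space, hence locally exact. *)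
Lemma parallel_exists : flat_normal_bundle M N ->
  exists O xi, [/\ open O, O p & parallel_field M (N `&` O) xi].
Proof.
move=> flat; pose V1 := V `&` [set x | V (r x)].
have oV1 : open V1.
  by apply: open_preimage_on => // x Vx; exact: smooth_on_continuous rs Vx.
have V1p : V1 p by split => //=; rewrite (adapted_fix ad) //; exact: VW.
have V1V : V1 `<=` V by move=> x [].
have rs1 := smooth_on_sub V1V rs.
have trs : smooth_on V1 (t \o r).
  by apply: (smooth_on_comp oV1 oV _ ts rs1) => x [].
(* The vector representing the pull-back r^* t, that is dot u (w x) = t(dr(u)) at r x. *)
pose w x := (t \o r) x *m (jac r x)^T.
have ws : smooth_on V1 w.
  apply: smooth_on_rV => // i; apply: (smooth_mxM oV1).
    exact: smooth_mx_rV.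
  by apply: smooth_mx_tr; exact: smooth_mx_jac.
have wE x u : V1 x -> dot u (w x) = dot ('D_u r x) ((t \o r) x).
  move=> V1x; rewrite (derive_jac u (smooth_on_diff rs1 V1x)).
  by rewrite /w dot_mulmxr trmxK.
(* The term with the second derivative of r is symmetric in u and v; the other one involves t at r x
   on vectors tangent to N, where closedness is known. *)
have wD x u v : V1 x -> dot u ('D_v w x) =
    dot ('D_v ('D_u r) x) ((t \o r) x) + dot ('D_u r x) ('D_('D_v r x) t (r x)).
  move=> V1x; have Vrx : V (r x) by case: V1x.
  rewrite -(derive_dotr u v (smooth_on_diff ws V1x)).
  apply: (etrans (derive_ext v oV1 V1x (fun y => wE y u))).
  apply: (etrans (derive_dot v (smooth_on_diff (smooth_on_derive u rs1) V1x)
    (smooth_on_diff trs V1x))).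
  congr (_ + dot _ _).
  exact: derive_compE v (smooth_on_diff rs1 V1x) (smooth_on_diff ts Vrx).
have wclosed x u v : V1 x -> dot u ('D_v w x) = dot v ('D_u w x).
  move=> V1x; have [Vx Vrx] := V1x; have Wx := VW Vx.
  have [Nrx Wrx] := adapted_im ad Wx.
  have Tr a : tangent N (r x) ('D_a r x) by exact: (tangentN_derive ad).
  apply: (etrans (wD x u v V1x)); apply/esym; apply: (etrans (wD x v u V1x)).
  have add_eq (a a' b : E) (c d : R) : a = a' -> c = d ->
      dot a b + c = dot a' b + d by move=> -> ->.
  exact: add_eq (Schwarz_rV v u oV1 rs1 V1x)
    (flat_form_closed flat Vrx Nrx (Tr v) (Tr u)).
have [d /= d0 dV1] := (@nbhs_ballP R E p _).1 (open_nbhs_nbhs (conj oV1 V1p)).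
have oB : open (ball p d) by exact: ball_open.
have Bp : ball p d p by exact: ballxx.
have wsB := smooth_on_sub dV1 ws.
have [|phi phiP] := @poincare_ball R n.+2 p d w wsB.
  by move=> x u v /dV1; exact: wclosed.
have phis : smooth_on (ball p d) phi.
  apply: (@smooth_on_primitive R E R (ball p d) phi (fun v x => dot v (w x))) => //.
  - by move=> x /phiP[].
  - by move=> v x /phiP[_]; exact.
  - by move=> v; apply: smooth_on_dot => //; exact: smooth_on_cst.
have nphis := smooth_onN oB phis.
(* An integrating factor: on N the forms r^* t and t agree on tangent vectors, so D_v e = - e t(v)
   cancels the component of D_v x0 along x0. *)
pose e x := expR (- phi x).
have es : smooth_on (ball p d) e by exact: smooth_on_exp.
have e0 x : e x != 0 by rewrite gt_eqF // expR_gt0.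
pose xi x := e x *: x0 x.
have x0sB : smooth_on (ball p d) x0 by apply: smooth_on_sub x0s => x /dV1/V1V.
have xis : smooth_on (ball p d) xi by exact: smooth_onZ.
have xia : smooth_along (N `&` ball p d) xi.
  by move=> q [Nq Bq]; exists (ball p d), xi; split.
have xiD q v : ball p d q -> N q -> tangent N q v -> tangent N q ('D_v xi q).
  move=> Bq Nq Tv; have Vq := V1V _ (dV1 _ Bq); have Wq := VW Vq.
  have De : 'D_v e q = - (e q * dot v (t q)).
    apply: (etrans (derive_expR_comp v (smooth_on_diff nphis Bq)).2).
    rewrite -mulrN; congr (e q * _).
    have -> : 'D_v (fun x => - phi x) q = - 'D_v phi q.
      exact: deriveN (diff_derivable (smooth_on_diff phis Bq)).
    rewrite (phiP q Bq).2 (wE q v (dV1 _ Bq)) /= (adapted_fix ad Wq Nq).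
    by rewrite ((adapted_tangentN ad _ Wq Nq).1 Tv).
  have -> : 'D_v xi q = e q *: ('D_v x0 q - dot v (t q) *: x0 q).
    apply: (etrans (derive_scale v (smooth_on_diff es Bq)
      (smooth_on_diff x0sB Bq))).
    by rewrite De scalerBr scalerA scaleNr addrC.
  by apply: (tangentNZ ad) => //; exact: x0t.
have xiDN q : (N `&` ball p d) q -> forall v, tangent (N `&` ball p d) q v ->
    tangent N q (flatD (N `&` ball p d) xi q v).
  move=> [Nq Bq] v /(tangent_setI _ _ oB Bq) Tv.
  rewrite (flatD_extension oB oB Bq Bq xis (fun _ _ _ => erefl) Tv).
  exact: xiD.
exists (ball p d), xi; split => //; split; first split; first split => //.
- move=> q [Nq Bq]; have Vq := V1V _ (dV1 _ Bq); have Wq := VW Vq.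
  have [TM nTN] := darboux_transversal oV Vq Nq dx0.
  split; first exact: (tangentMZ ad).
  move=> /(tangent_setI _ _ oB Bq) TN; apply: nTN.
  by rewrite -[x0 q]scale1r -(mulVf (e0 q)) -scalerA; exact: (tangentNZ ad).
- by move=> q Sq v Tv; exact/(adapted_NM ad)/xiDN.
- move=> q Sq v Tv; have [Nq Bq] := Sq.
  by apply/(tangent_setI _ _ oB Bq); exact: xiDN.
Qed.

End Integration.

Lemma flat_parallel p : W p -> N p -> nondegenerate_immersion M N ->
  flat_normal_bundle M N ->
  exists O xi, [/\ open O, O p & parallel_field M (N `&` O) xi].
Proof.
move=> Wp Np nd flat.
have [U1 [xi1 [eta [[oO Op xi1T etaT] ndO]]]] := nd p Np.
have ndq q : N q -> U1 q -> W q -> nondegenerate_at N F q.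
  move=> Nq Oq Wq; apply: (nondegenerate_hess ad oO Oq Nq Wq xi1T etaT).
  exact: ndO.
have [V [x0 [oV Vp VW x0s dx0]]] := darboux_exists ad oO Op Np Wp xi1T ndq.
have [V1 [t [oV1 V1V V1p ts x0t]]] := normal_connection_form oV VW x0s dx0 Vp Np.
apply: (parallel_exists oV1 _ V1p Np (smooth_on_sub V1V x0s) ts _ x0t flat).
  by move=> x /V1V/VW.
(* At points of [V1] the tangent spaces and the derivative along N are the same for V and [V1], so
   the Darboux field restricts. *)
have [[_ x0T] x0D] := dx0.
have TV q v : V1 q -> tangent (N `&` V1) q v <-> tangent (N `&` V) q v.
  move=> V1q; rewrite (tangent_setI _ _ oV1 V1q).
  by rewrite (tangent_setI _ _ oV (V1V _ V1q)).
split; first split.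
- by move=> q [Nq V1q]; exists V1, x0; split => //; exact: smooth_on_sub V1V x0s.
- move=> q [Nq V1q]; have [TM nTN] := x0T q (conj Nq (V1V _ V1q)).
  by split => // /(TV _ _ V1q).
- move=> q [Nq V1q] v /(TV _ _ V1q) Tv; have Vq := V1V _ V1q.
  have := x0D q (conj Nq Vq) v Tv.
  have TNv := (tangent_setI _ _ oV Vq).1 Tv.
  rewrite (flatD_extension oV oV Vq Vq x0s (fun _ _ _ => erefl) TNv).
  by rewrite (flatD_extension oV oV1 Vq V1q x0s (fun _ _ _ => erefl) TNv).
Qed.

(** The curvature formula is used with an extension g of the parallel field in place of x0: then t =
    0 is admissible, and lambda xi0 is a multiple f g of it along N by [darboux_line]. *)
Lemma parallel_flat O O' xi xi0 (lambda : E -> R) X Y p :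
  nondegenerate_immersion M N -> open O -> open O' -> O p -> O' p -> N p -> W p ->
  parallel_field M (N `&` O') xi -> darboux_field M (N `&` O) xi0 ->
  smooth_along (N `&` O) lambda ->
  tangent_field (N `&` O) X -> tangent_field (N `&` O) Y ->
  normal_curvature (N `&` O) xi0 X Y (fun q => lambda q *: xi0 q) p = 0.
Proof.
move=> nd oO oO' Op O'p Np Wp [dxi xip] dxi0 ls TX TY.
have [U1 [xi1 [eta [[oO1 O1p xi1T etaT] ndO]]]] := nd p Np.
have [V [g [oV Vp VWO gs gE]]] :=
  smooth_along_extension ad oO' dxi.1.1 Wp Np O'p.
have [V0 [g0 [oV0 V0p V0WO g0s g0E]]] :=
  smooth_along_extension ad oO dxi0.1.1 Wp Np Op.
have [V' [l [oV' V'p V'WO lsm lE]]] := smooth_along_extension ad oO ls Wp Np Op.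
pose V2 := (V `&` [set x | dot (g x) (g x) != 0]) `&` (V0 `&` (V' `&` U1)).
have nz q : V q -> N q -> dot (g q) (g q) != 0.
  move=> Vq Nq; have [Wq O'q] := VWO q Vq; rewrite gE //.
  apply: (nontangent_dot_neq0 Wq Nq).
  exact: (darboux_transversal oO' O'q Nq dxi).2.
have oV2 : open V2.
  apply: openI; first by apply: open_neq0 => //; exact: smooth_on_dot.
  by apply: openI => //; exact: openI.
have V2p : V2 p by split => //; split => //=; exact: nz.
have V2V : V2 `<=` V by move=> x [[]].
have V2V0 : V2 `<=` V0 by move=> x [_ []].
have V2V' : V2 `<=` V' by move=> x [_ [_ []]].
have V2O1 : V2 `<=` U1 by move=> x [_ [_ []]].
have V2WO : V2 `<=` W `&` O by move=> x /V2V0/V0WO.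
have {}gs := smooth_on_sub V2V gs; have {}g0s := smooth_on_sub V2V0 g0s.
have {}lsm := smooth_on_sub V2V' lsm.
(* The factor c in xi0 = c g comes pointwise, without smoothness. It is recovered as the quotient of
   scalar products dot xi0 g / dot g g, smooth since g vanishes nowhere on [V2]. *)
pose f x := l x * (dot (g0 x) (g x) * (dot (g x) (g x))^-1).
have fs : smooth_on V2 f.
  apply: smooth_onM => //; apply: smooth_onM => //; first exact: smooth_on_dot.
  apply: smooth_onV => //; last exact: smooth_on_dot.
  by move=> x [[]].
have t0s : smooth_on V2 (fun _ : E => 0 : E) by exact: smooth_on_cst.
have line q : V2 q -> N q -> exists c : R, c != 0 /\ xi0 q = c *: g q.
  move=> V2q Nq; have [Wq Oq] := V2WO q V2q; have Vq := V2V q V2q.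
  have [_ O'q] := VWO q Vq; have O1q := V2O1 q V2q; rewrite gE //.
  apply: (darboux_line ad oO' O'q oO Oq Nq Wq dxi dxi0).
  by apply: (nondegenerate_hess ad oO1 O1q Nq Wq xi1T etaT); exact: ndO.
rewrite (normal_curvatureE (xi0 := xi0) (t := fun=> 0) (x0 := g) (f := f)
  ad oO oV2 V2WO gs t0s line _ _ fs _ TX TY V2p Np).
- by rewrite !derive_cst !dot0r subrr mulr0 scale0r.
- move=> q V2q Nq; have Vq := V2V q V2q; have [Wq O'q] := VWO q Vq.
  rewrite gE //; exact: (darboux_transversal oO' O'q Nq dxi).2.
- move=> q v V2q Nq Tv; have Vq := V2V q V2q; have [Wq O'q] := VWO q Vq.
  rewrite dot0r scale0r subr0.
  have gE2 x : V2 x -> N x -> g x = xi x by move=> /V2V; exact: gE.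
  rewrite -(flatD_extension oV2 oO' V2q O'q gs gE2 Tv).
  apply/(tangent_setI _ _ oO' O'q); apply: xip => //.
  exact/(tangent_setI _ _ oO' O'q).
- move=> q V2q Nq; have [c [c0 cE]] := line q V2q Nq.
  rewrite /f (lE q (V2V' _ V2q) Nq) (g0E q (V2V0 _ V2q) Nq) cE dotZl.
  by rewrite mulfK ?scalerA // nz //; exact: V2V.
Qed.

End WithAdapted.
End FlatParallel.

Theorem proposition7p2 (R : realType) (n : nat) (M N : set 'rV[R]_n.+2)
    (hM : submanifold n.+1 M) (hN : submanifold n N) (hNM : N `<=` M)
    (hnd : nondegenerate_immersion M N) :
  locally_has_parallel_field M N <-> flat_normal_bundle M N.
Proof.
have adp p : N p -> exists W r F, adapted M N W r F /\ W p.
  exact: adapted_exists.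
split=> [par O xi0 oO dxi0 lambda X Y ls TX TY p [Np Op]|flat p Np].
  have [W [r [F [ad Wp]]]] := adp p Np.
  have [U1 [xi [oO1 O1p dxi]]] := par p Np.
  exact: (parallel_flat ad hnd oO oO1 Op O1p Np Wp dxi dxi0 ls TX TY).
have [W [r [F [ad Wp]]]] := adp p Np.
exact: (flat_parallel ad Wp Np hnd flat).
Qed.
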